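(* For every $n\ge2$, the unimodal spi-logic $\mathsf{SPi}^n_{equiv}=\mathsf{SPi}+\{p\to\Diamond p,\ \Diamond\Diamond p\to\Diamond p,\ q\wedge\Diamond p\to\Diamond(p\wedge\Diamond q),\ \iota^n_{fun}\}$ is decidable in polynomial time.
   Context: Unimodal setting: one diamond $\Diamond$. Sp-formulas: built from propositional variables and $\top$ by $\wedge$ and $\Diamond$; sp-implications $\sigma\to\tau$. A SLO is an algebra $(A,\wedge,\top,\Diamond)$ with $(A,\wedge,\top)$ a meet-semilattice with top and $\Diamond$ monotone; it validates $\sigma\to\tau$ if $\sigma[\mathfrak a]\le\tau[\mathfrak a]$ for all valuations. $\mathsf{SPi}+\Sigma$ is the set of sp-implications valid in every SLO validating $\Sigma$; decidability refers to deciding membership. For $P=\{p_0,\dots,p_n\}$, $\iota^n_{fun}=\big(\bigwedge_{Q\subseteq P,|Q|=n}\Diamond\bigwedge Q\to\Diamond\bigwedge P\big)$. *)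

(* Defs.v *)
From Stdlib Require Import BinNat BinPos.
From mathcomp Require Import all_boot.

Set Implicit Arguments.
Unset Strict Implicit.
Unset Printing Implicit Defensive.

Inductive spform : Type :=
  | Var : nat -> spform
  | Top : spform
  | And : spform -> spform -> spform
  | Dia : spform -> spform.

Definition spimp : Type := (spform * spform)%type.
Definition Imp (s t : spform) : spimp := (s, t).

Definition bigAnd (l : seq spform) : spform := foldr And Top l.

Record SLO : Type := {
  car :> Type;
  meet : car -> car -> car;
  top : car;
  dia : car -> car;
  meetA : forall x y z, meet x (meet y z) = meet (meet x y) z;
  meetC : forall x y, meet x y = meet y x;
  meetxx : forall x, meet x x = x;
  meetxT : forall x, meet x top = x;
  dia_mono : forall x y, meet x y = x -> meet (dia x) (dia y) = dia x
}.

Definition sle (A : SLO) (x y : A) : Prop := meet x y = x.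

Fixpoint eval (A : SLO) (v : nat -> A) (f : spform) : A :=
  match f with
  | Var k => v k
  | Top => top A
  | And f g => meet (eval v f) (eval v g)
  | Dia f => dia (eval v f)
  end.

Definition validates (A : SLO) (i : spimp) : Prop :=
  forall v : nat -> A, sle (eval v i.1) (eval v i.2).

Definition SPi_plus (Sigma : spimp -> Prop) : spimp -> Prop :=
  fun i => forall A : SLO, (forall s, Sigma s -> validates A s) -> validates A i.

Definition p_ := Var 0.
Definition q_ := Var 1.

Definition iota_fun (n : nat) : spimp :=
  Imp (bigAnd [seq Dia (bigAnd [seq Var (nat_of_ord i) | i : 'I_n.+1 <- enum Q])
              | Q : {set 'I_n.+1} <- enum [set Q : {set 'I_n.+1} | #|Q| == n]])
      (Dia (bigAnd [seq Var i | i <- iota 0 n.+1])).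

Definition Sigma_equiv (n : nat) : spimp -> Prop :=
  fun i =>
    i = Imp p_ (Dia p_) \/
    i = Imp (Dia (Dia p_)) (Dia p_) \/
    i = Imp (And q_ (Dia p_)) (Dia (And p_ (Dia q_))) \/
    i = iota_fun n.

Definition SPi_equiv (n : nat) : spimp -> Prop := SPi_plus (Sigma_equiv n).

Inductive sym : Type :=
  | SVar | S0 | S1 | SEnd | STop | SAnd | SDia | SImp.

Fixpoint pos_bits (p : positive) : seq sym :=
  match p with
  | xH => [:: S1]
  | xO p' => rcons (pos_bits p') S0
  | xI p' => rcons (pos_bits p') S1
  end.

Definition nat_bits (k : nat) : seq sym :=
  match N.of_nat k with
  | N0 => [:: S0]
  | Npos p => pos_bits p
  end.

Fixpoint enc_form (f : spform) : seq sym :=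
  match f with
  | Var k => SVar :: nat_bits k ++ [:: SEnd]
  | Top => [:: STop]
  | And f g => SAnd :: enc_form f ++ enc_form g
  | Dia f => SDia :: enc_form f
  end.

Definition enc_imp (i : spimp) : seq sym := enc_form i.1 ++ SImp :: enc_form i.2.

(* Deterministic single-tape Turing machines (bi-infinite tape).       *)
Inductive dir : Type := MoveL | MoveR | Stay.

Record TM (Sigma : Type) : Type := {
  tm_state : finType;
  tm_gamma : finType;
  tm_blank : tm_gamma;
  tm_input : Sigma -> tm_gamma;
  tm_start : tm_state;
  tm_accept : tm_state;
  tm_reject : tm_state;
  tm_delta : tm_state -> tm_gamma -> tm_state * tm_gamma * dir
}.

Section TMsem.
Variables (Sigma : Type) (M : TM Sigma).

(* configuration: state, tape left of the head (nearest first),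
   tape from the head rightwards (head reads the first cell). *)
Definition config : Type :=
  (tm_state M * seq (tm_gamma M) * seq (tm_gamma M))%type.

Definition halted (q : tm_state M) : bool :=
  (q == tm_accept M) || (q == tm_reject M).

Definition tm_step (c : config) : config :=
  let: (q, l, r) := c in
  if halted q then c else
  let a := head (tm_blank M) r in
  let: (q', b, d) := tm_delta q a in
  let r' := b :: behead r in
  match d with
  | Stay => (q', l, r')
  | MoveR => (q', b :: l, behead r)
  | MoveL => match l with
             | x :: l' => (q', l', x :: r')
             | [::] => (q', [::], tm_blank M :: r')
             end
  end.

Definition tm_init (w : seq Sigma) : config :=
  (tm_start M, [::], map (tm_input M) w).

Definition tm_run (k : nat) (w : seq Sigma) : config := iter k tm_step (tm_init w).

Definition cstate (c : config) : tm_state M := c.1.1.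

Definition decides_in_time (L : seq Sigma -> Prop) (T : nat -> nat) : Prop :=
  forall w, exists k, k <= T (size w) /\
    halted (cstate (tm_run k w)) /\
    (cstate (tm_run k w) = tm_accept M <-> L w).

End TMsem.

Definition poly_time_decidable (Sigma : Type) (L : seq Sigma -> Prop) : Prop :=
  exists (M : TM Sigma) (c d : nat),
    decides_in_time M L (fun m => c * m.+1 ^ d).

Definition logic_language (Lg : spimp -> Prop) : seq sym -> Prop :=
  fun w => exists i, w = enc_imp i /\ Lg i.

(* Main.v *)
From HB Require Import structures.
Require Import Defs.
From Stdlib Require Import FunctionalExtensionality PropExtensionality ProofIrrelevance.
From Stdlib Require Import BinNat BinPos Nnat.
From mathcomp Require Import all_boot zify.

Set Implicit Arguments.
Unset Strict Implicit.
Unset Printing Implicit Defensive.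

(* Modulo the S5 axioms a formula is a cluster of sets of variables, one of
   them being the root, and iota_fun says that a set belongs to the cluster as
   soon as it is covered by n+1 pieces any n of which lie together in a member.
   This is a near-unanimity rule, so (as in the Baker-Pixley theorem) a set is
   derivable iff each of its n-element subsets lies in a member.  Hence f -> g
   is derivable iff the root variables of g are among those of f and any n
   variables at a node of g occur together at a node of f.

   In the Polish notation of formulas this condition is expressible by
   first-order quantification over positions together with the comparison of
   cardinalities #{x | f} <= #{x | g}, which takes care of bracketing and of the
   comparison of variable names.  Any such formula is evaluated in polynomial
   time by nested loops moving finitely many marks along the input, and moving
   or comparing marks is a left-to-right sweep of a Turing machine. *)

(** The pigeonhole principle ties the criterion to [iota_fun]: n variables, each taken from one of
    n+1 pieces, miss some piece entirely, so the rule never creates a new n-tuple. Conversely, a set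
    of more than n variables splits into n+1 nonempty pieces, so the rule builds it from smaller
    sets, down to those with n elements. Polynomial time refers to a concrete single-tape machine,
    and programming one for formulas directly would be unwieldy; the detour through logic confines
    the machine work to four tape primitives. Counting is there because the order of positions alone
    lets a first-order formula neither find the end of a subformula in Polish notation nor compare
    two distances. As n is fixed, an n-tuple of positions costs n nested quantifiers and only raises
    the degree of the time bound. *)

(** * The syntactic criterion *)

Fixpoint root_vars (f : spform) : seq nat :=
  match f with
  | Var k => [:: k]
  | Top => [::]
  | And f g => root_vars f ++ root_vars g
  | Dia _ => [::]
  end.

(* The label of a subformula is contained in that of the node at which it
   stands, so listing all subformulas instead of all nodes is harmless. *)
Fixpoint labels (f : spform) : seq (seq nat) :=
  root_vars f :: match f with
          | And g h => labels g ++ labels h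
          | Dia g => labels g
          | _ => [::]
          end.

(** [Z] is a list and may repeat entries, so for n > 0 it ranges over all nonempty sets of at most n
    variables. *)
Definition label_crit (n : nat) (f g : spform) : Prop :=
  {subset root_vars g <= root_vars f} /\
  forall Z P, size Z = n -> P \in labels g -> {subset Z <= P} ->
    exists2 P', P' \in labels f & {subset Z <= P'}.

Lemma rt_labs f : root_vars f \in labels f.
Proof. by case: f => * /=; rewrite inE eqxx. Qed.

(** * Order and finite meets in a SLO *)

Section SLOTheory.
Variable A : SLO.
Implicit Types x y : A.

Lemma sle_refl x : sle x x.
Proof. exact: meetxx. Qed.

Lemma sle_trans y x z : sle x y -> sle y z -> sle x z.
Proof. by rewrite /sle => xy yz; rewrite -xy -meetA yz. Qed.

Lemma sle_meetl x y : sle (meet x y) x.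
Proof. by rewrite /sle meetC meetA meetxx. Qed.

Lemma sle_meetr x y : sle (meet x y) y.
Proof. by rewrite meetC; exact: sle_meetl. Qed.

Lemma sle_meet x y z : sle x y -> sle x z -> sle x (meet y z).
Proof. by rewrite /sle => xy xz; rewrite meetA xy xz. Qed.

Lemma sle_top x : sle x (top A).
Proof. exact: meetxT. Qed.

Lemma sle_dia x y : sle x y -> sle (dia x) (dia y).
Proof. exact: dia_mono. Qed.

Lemma sle_bigAnd (I : eqType) (v : nat -> A) x (F : I -> spform) (s : seq I) :
  sle x (eval v (bigAnd [seq F i | i <- s])) <->
  (forall i, i \in s -> sle x (eval v (F i))).
Proof.
elim: s => [|i s IH] /=; first by split=> // _; exact: sle_top.
split=> [h j|h].
  rewrite inE => /orP[/eqP->|js]; first exact: sle_trans h (sle_meetl _ _).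
  by apply IH => //; exact: sle_trans h (sle_meetr _ _).
apply: sle_meet; first by apply: h; rewrite inE eqxx.
by apply IH => j js; apply: h; rewrite inE js orbT.
Qed.

Definition conj (v : nat -> A) (P : seq nat) : A := eval v (bigAnd [seq Var k | k <- P]).

Lemma sle_conj v x P : sle x (conj v P) <-> (forall k, k \in P -> sle x (v k)).
Proof. exact: sle_bigAnd. Qed.

Lemma conj_sub v P P' : {subset P <= P'} -> sle (conj v P') (conj v P).
Proof.
move=> sub; apply/sle_conj => k kP.
have /sle_conj h := sle_refl (conj v P').
exact/h/sub.
Qed.

Lemma eval_conj_rt v f : sle (eval v f) (conj v (root_vars f)).
Proof.
elim: f => [k||f IHf g IHg|f _] //=.
- by apply/sle_conj => j; rewrite inE => /eqP->; exact: sle_refl.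
- exact: sle_refl.
- apply/sle_conj => k; rewrite mem_cat => /orP[] h.
    by move/sle_conj: IHf => /(_ _ h); exact: sle_trans (sle_meetl _ _).
  by move/sle_conj: IHg => /(_ _ h); exact: sle_trans (sle_meetr _ _).
- exact: sle_top.
Qed.

End SLOTheory.

(** * Sufficiency of the criterion in every algebra validating the axioms *)

Section Soundness.
Variables (n : nat) (A : SLO).
Hypothesis n_gt0 : 0 < n.
Hypothesis hA : forall s, Sigma_equiv n s -> validates A s.
Implicit Types x y : A.

Lemma sle_diar x : sle x (dia x).
Proof. exact: (hA (or_introl erefl) (fun _ => x)). Qed.

Lemma sle_diadia x : sle (dia (dia x)) (dia x).
Proof. exact: (hA (or_intror (or_introl erefl)) (fun _ => x)). Qed.

Lemma sle_sym x y : sle (meet y (dia x)) (dia (meet x (dia y))).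
Proof.
exact: (hA (or_intror (or_intror (or_introl erefl))) (fun k => if k is 0 then x else y)).
Qed.

(** The sets of n indices in [iota_fun] are the complements of single indices, so there is one
    premise per omitted index. The witness [y] need not be a conjunction of the [a j]; lying below
    them is enough, by monotonicity of the diamond. *)
Lemma sle_threshold x (a : nat -> A) :
  (forall i, i <= n -> exists2 y, sle x (dia y) &
                         forall j, j <= n -> j != i -> sle y (a j)) ->
  exists2 y, sle x (dia y) & forall j, j <= n -> sle y (a j).
Proof.
move=> h; exists (eval a (bigAnd [seq Var i | i <- iota 0 n.+1])); last first.
  move=> j jn; have /sle_bigAnd := sle_refl (eval a (bigAnd [seq Var i | i <- iota 0 n.+1])).
  by apply; rewrite mem_iota.
apply: sle_trans (hA (or_intror (or_intror (or_intror erefl))) a).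
apply/sle_bigAnd => Q; rewrite mem_enum inE => /eqP cQ.
have [i iQ] : exists i, i \notin Q.
  apply/existsP; rewrite -negb_forall; apply/negP => /forallP all.
  have : #|Q| = #|'I_n.+1| by apply: eq_card => i; rewrite all.
  by rewrite cQ card_ord; lia.
have [|y xy ya] := h i; first by rewrite -ltnS.
apply: sle_trans xy _; apply: sle_dia; apply/sle_bigAnd => j.
rewrite mem_enum => jQ; apply: ya; first by rewrite -ltnS.
by apply: contraNneq iQ => /ord_inj<-.
Qed.

(* The elements of [P] are distributed over [n.+1] nonempty classes; leaving
   out any one of the classes gives a smaller set. *)
Lemma sle_dia_conj v x P :
  (forall Z, size Z = n -> {subset Z <= P} -> sle x (dia (conj v Z))) ->
  sle x (dia (conj v P)).
Proof.
move=> h; have {h} : forall Z, size Z = n -> {subset Z <= undup P} -> sle x (dia (conj v Z)).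
  by move=> Z sZ ZP; apply: h => // z /ZP; rewrite mem_undup.
suff main : forall Q, uniq Q ->
    (forall Z, size Z = n -> {subset Z <= Q} -> sle x (dia (conj v Z))) ->
    sle x (dia (conj v Q)).
  move=> /(main _ (undup_uniq P)) h; apply: sle_trans h _.
  by apply/sle_dia/conj_sub => z; rewrite mem_undup.
move=> Q; have [N] := ubnP (size Q); elim: N Q => // N IH Q ltQ uQ h.
have [leQ|gtQ] := leqP (size Q) n.
  case: Q => [|k Q] in leQ uQ h ltQ *.
    by apply: sle_trans (sle_diar x) _; exact/sle_dia/sle_top.
  (* At most n variables: repeating one of them pads the list to length n, where the hypothesis
     applies. *)
  have sub : k :: Q ++ nseq (n - (size Q).+1) k =i k :: Q.
    move=> z; rewrite inE mem_cat mem_nseq inE.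
    by case: (z == k); rewrite //= andbF orbF.
  apply: sle_trans (h (k :: Q ++ nseq (n - (size Q).+1) k) _ _) _.
  - by rewrite /= size_cat size_nseq; move: leQ => /=; lia.
  - by move=> z; rewrite sub.
  - by apply/sle_dia/conj_sub => z; rewrite sub.
(* The first n elements form singleton classes and class n collects the rest, which is nonempty
   because Q has more than n elements. *)
pose cl z := minn (index z Q) n.
pose a i := conj v [seq z <- Q | cl z == i].
have [i lein|y xy ya] := @sle_threshold x a.
  pose Q' := [seq z <- Q | cl z != i].
  exists (conj v Q').
    apply: IH; first 2 [exact: filter_uniq].
    - suff : 0 < count [pred z | cl z == i] Q.
        have := count_predC [pred z | cl z == i] Q.
        rewrite size_filter (eq_count (_ : predC _ =1 fun z => cl z != i)) //.
        by move: ltQ; lia.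
      rewrite -has_count; apply/hasP; exists (nth 0 Q i); first by apply: mem_nth; lia.
      by rewrite /= /cl index_uniq //; lia.
    - by move=> Z sZ ZQ; apply: h => // z /ZQ; rewrite mem_filter => /andP[].
  move=> j _ ji; apply: conj_sub => z; rewrite !mem_filter => /andP[/eqP-> ->].
  by rewrite ji.
apply: sle_trans xy _; apply: sle_dia; apply/sle_conj => k kQ.
apply: sle_trans (ya (cl k) (geq_minr _ _)) _.
have /sle_conj := sle_refl (a (cl k)); apply.
by rewrite mem_filter eqxx.
Qed.

Lemma eval_dia_labs (v : nat -> A) f P : P \in labels f -> sle (eval v f) (dia (conj v P)).
Proof.
have root g : sle (eval v g) (dia (conj v (root_vars g))).
  exact: sle_trans (eval_conj_rt v g) (sle_diar _).
elim: f P => [k||f IHf g IHg|f IHf] P.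
- by rewrite inE => /eqP->; exact: root.
- by rewrite inE => /eqP->; exact: root.
- rewrite [labels _]/= inE => /orP[/eqP->|]; first exact: (root (And f g)).
  rewrite mem_cat => /orP[/IHf|/IHg] /= h.
    exact: sle_trans (sle_meetl _ _) h.
  exact: sle_trans (sle_meetr _ _) h.
- rewrite [labels _]/= inE => /orP[/eqP->|]; first exact: (root (Dia f)).
  by move=> /IHf h; exact: sle_trans (sle_dia h) (sle_diadia _).
Qed.

(** The tree shape of [g] is irrelevant. For a diamond, the symmetry axiom moves to a point where
    the root variables of the argument hold and [dia x] holds; by transitivity every label seen from
    [x] is still seen from there, so the induction hypothesis applies at that point. *)
Lemma sle_eval v x g :
  sle x (conj v (root_vars g)) -> (forall P, P \in labels g -> sle x (dia (conj v P))) ->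
  sle x (eval v g).
Proof.
elim: g x => [k||f IHf g IHg|g IHg] x /=.
- by move=> /sle_conj/(_ k) + _; apply; rewrite inE.
- by move=> _ _; exact: sle_top.
- move=> /sle_conj xr xl; apply: sle_meet.
    apply: IHf => [|P Pf]; first by apply/sle_conj => k kf; apply: xr; rewrite mem_cat kf.
    by apply: xl; rewrite inE mem_cat Pf orbT.
  apply: IHg => [|P Pg]; first by apply/sle_conj => k kf; apply: xr; rewrite mem_cat kf orbT.
  by apply: xl; rewrite inE mem_cat Pg !orbT.
- move=> _ xl.
  apply: (@sle_trans _ (meet x (dia (conj v (root_vars g))))).
    by apply: sle_meet (sle_refl _) _; apply: xl; rewrite inE rt_labs orbT.
  apply: sle_trans (sle_sym _ _) _; apply/sle_dia/IHg; first exact: sle_meetl.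
  move=> P Pg; apply: sle_trans (sle_meetr _ _) _.
  apply: sle_trans (sle_diadia _); apply: sle_dia.
  by apply: xl; rewrite inE Pg orbT.
Qed.

Lemma crit_sound f g : label_crit n f g -> validates A (f, g).
Proof.
move=> [sub h] v /=; apply: sle_eval.
  exact: sle_trans (eval_conj_rt v f) (conj_sub v sub).
move=> P Pg; apply: sle_dia_conj => Z sZ /(h _ _ sZ Pg)[P' P'f ZP'].
exact: sle_trans (eval_dia_labs v P'f) (sle_dia (conj_sub v ZP')).
Qed.

End Soundness.

(** * The separating algebra *)

Section Separation.
Variable n : nat.
Hypothesis n_gt0 : 0 < n.

(* [(R, C)] stands for a formula with root variables [R] such that the
   [n]-tuples in [C] occur together somewhere in its cluster. *)
Definition cluster_ok (x : (nat -> Prop) * (seq nat -> Prop)) : Prop :=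
  forall Z, size Z = n -> (forall z, z \in Z -> x.1 z) -> x.2 Z.

Definition cluster : Type := {x : (nat -> Prop) * (seq nat -> Prop) | cluster_ok x}.

Definition croot (x : cluster) := (sval x).1.
Definition cfam (x : cluster) := (sval x).2.

Lemma cluster_ext (x y : cluster) :
  (forall z, croot x z <-> croot y z) -> (forall Z, cfam x Z <-> cfam y Z) -> x = y.
Proof.
case: x y => [[R C] hx] [[R' C'] hy]; rewrite /croot /cfam /= => hR hC.
have ER : R = R' by apply: functional_extensionality => z; exact: propositional_extensionality.
have EC : C = C' by apply: functional_extensionality => z; exact: propositional_extensionality.
by subst; congr exist; exact: proof_irrelevance.
Qed.

(** The union of two root sets contains n-tuples that lie in neither of them; the third alternative
    adds exactly the tuples that the closure condition demands. *)
Lemma cmeet_ok (x y : cluster) :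
  cluster_ok (fun z => croot x z \/ croot y z,
    fun Z => [\/ cfam x Z, cfam y Z |
      size Z = n /\ forall z, z \in Z -> croot x z \/ croot y z]).
Proof. by move=> Z sZ hZ; apply: Or33. Qed.

Definition cmeet (x y : cluster) : cluster := exist _ _ (@cmeet_ok x y).

Lemma ctop_ok : cluster_ok (fun=> False, fun=> False).
Proof. by case=> [|z Z] /= sZ; [move: n_gt0; rewrite -sZ | move=> /(_ z); rewrite inE eqxx => /(_ isT)]. Qed.

Definition ctop : cluster := exist _ _ (@ctop_ok).

Lemma cdia_ok (x : cluster) : cluster_ok (fun=> False, cfam x).
Proof. by move=> Z sZ /(ctop_ok sZ). Qed.

Definition cdia (x : cluster) : cluster := exist _ _ (@cdia_ok x).

Lemma cfam_root (x : cluster) Z : size Z = n -> (forall z, z \in Z -> croot x z) -> cfam x Z.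
Proof. exact: (proj2_sig x). Qed.

Definition cle (x y : cluster) :=
  (forall z, croot y z -> croot x z) /\ (forall Z, cfam y Z -> cfam x Z).

Lemma cleP x y : cmeet x y = x <-> cle x y.
Proof.
split=> [xy|[hR hC]].
  by split=> z hz; rewrite -xy; [right | apply: Or32].
apply: cluster_ext => z; rewrite /croot /cfam /=; split=> [| hz]; try by [left | apply: Or31].
  by case=> // /hR.
case=> // [/hC //|[sz h]]; apply: cfam_root => // u /h[] // ; exact: hR.
Qed.

Lemma cmeetC x y : cmeet x y = cmeet y x.
Proof.
apply: cluster_ext => z; rewrite /croot /cfam /=; first by split; case; [right|left|right|left].
by split; (case=> [h|h|[sz h]]; [exact: Or32 | exact: Or31 | apply: Or33; split=> // u /h[]; [right|left]]).
Qed.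

Lemma cmeetxx x : cmeet x x = x.
Proof. exact/cleP. Qed.

Lemma cmeetxT x : cmeet x ctop = x.
Proof. exact/cleP. Qed.

Lemma cmeetA x y z : cmeet x (cmeet y z) = cmeet (cmeet x y) z.
Proof.
apply: cluster_ext => u; rewrite /croot /cfam /=; first by
  split=> [[h|[h|h]]|[[h|h]|h]]; [left; left|left; right|right|left|right; left|right; right].
split.
- case=> [h|[h|h|[su h]]|[su h]].
  + by apply: Or31; apply: Or31.
  + by apply: Or31; apply: Or32.
  + by apply: Or32.
  + by apply: Or33; split=> // a /h[]; [left; right|right].
  + by apply: Or33; split=> // a /h[|[]]; [left; left|left; right|right].
- case=> [[h|h|[su h]]|h|[su h]].
  + by apply: Or31.
  + by apply: Or32; apply: Or31.
  + by apply: Or33; split=> // a /h[]; [left|right; left].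
  + by apply: Or32; apply: Or32.
  + by apply: Or33; split=> // a /h[[]|]; [left|right; left|right; right].
Qed.

Lemma cdia_mono x y : cmeet x y = x -> cmeet (cdia x) (cdia y) = cdia x.
Proof. by move=> /cleP[hR hC]; apply/cleP. Qed.

Definition cluster_SLO : SLO :=
  Build_SLO cmeetA cmeetC cmeetxx cmeetxT cdia_mono.

Lemma croot_bigAnd (I : eqType) (v : nat -> cluster_SLO) (F : I -> spform) s z :
  croot (eval v (bigAnd [seq F i | i <- s])) z <->
  exists2 i, i \in s & croot (eval v (F i)) z.
Proof.
elim: s => [|i s IH]; first by split=> // -[].
split=> [[h|/IH[j js h]]|[j]]; first by exists i; rewrite // inE eqxx.
  by exists j; rewrite // inE js orbT.
by rewrite inE => /orP[/eqP->|js] h; [left | right; apply/IH; exists j].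
Qed.

Lemma cfam_bigAnd (I : eqType) (v : nat -> cluster_SLO) (F : I -> spform) s Z :
  cfam (eval v (bigAnd [seq F i | i <- s])) Z ->
  (exists2 i, i \in s & cfam (eval v (F i)) Z) \/
  (size Z = n /\ forall z, z \in Z -> exists2 i, i \in s & croot (eval v (F i)) z).
Proof.
elim: s Z => [|i s IH] Z //= [h|/IH[[j js h]|[sZ h]]|[sZ h]].
- by left; exists i; rewrite // inE eqxx.
- by left; exists j; rewrite // inE js orbT.
- by right; split=> // z /h[j js hj]; exists j; rewrite // inE js orbT.
- right; split=> // z /h[hz|/croot_bigAnd[j js hj]]; first by exists i; rewrite // inE eqxx.
  by exists j; rewrite // inE js orbT.
Qed.

(** A tuple on the right either comes from the family of a single [v j], which occurs in the premise
    omitting some other index, or consists of root variables. In the latter case one index is chosen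
    for each of its n entries; some i among the n+1 indices is not chosen, and the premise omitting
    i already has the whole tuple at its root. *)
Lemma cluster_iota : validates cluster_SLO (iota_fun n).
Proof.
move=> v; set y := bigAnd [seq Var i | i <- iota 0 n.+1].
change (sle (eval v (iota_fun n).1) (dia (eval v y))); set x := eval v _.
have hx (i : 'I_n.+1) Z : cfam (eval v (bigAnd [seq Var (nat_of_ord j) | j <- enum [set~ i]])) Z -> cfam x Z.
  have /sle_bigAnd/(_ [set~ i]) : sle x x by exact: sle_refl.
  rewrite mem_enum inE cardsC1 card_ord eqxx => /(_ isT)/cleP[_]; exact.
apply/cleP; split=> // Z /cfam_bigAnd[[j]|[sZ hZ]].
  rewrite mem_iota /= add0n => jn hj.
  have [i ij] : exists i : 'I_n.+1, val i != j.
    by case: (posnP j) => [->|j0]; [exists (@Ordinal n.+1 1 n_gt0) | exists ord0; rewrite neq_ltn j0].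
  apply: (hx i).
  have /sle_bigAnd/(_ (Ordinal jn)) : sle (eval v (bigAnd [seq Var (nat_of_ord j) | j <- enum [set~ i]]))
      (eval v (bigAnd [seq Var (nat_of_ord j) | j <- enum [set~ i]])) by exact: sle_refl.
  rewrite mem_enum !inE -val_eqE eq_sym ij => /(_ isT)/cleP[_]; exact.
have [J hJ] : exists J : seq nat, size J = size Z /\
    forall z, z \in Z -> exists2 i, i \in J & i < n.+1 /\ croot (v i) z.
  elim: Z {sZ} hZ => [|z Z IH] hZ; first by exists [::].
  have [|J [sJ hJ]] := IH; first by move=> u uZ; apply: hZ; rewrite inE uZ orbT.
  have [|i] := hZ z; first by rewrite inE eqxx.
  rewrite mem_iota => /andP[_ lti] hi; exists (i :: J); split; first by rewrite /= sJ.
  move=> u; rewrite inE => /orP[/eqP->|/hJ[j jJ hj]]; first by exists i; rewrite ?inE ?eqxx.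
  by exists j; rewrite // inE jJ orbT.
case: hJ => sJ hJ.
have [i iJ] : exists i : 'I_n.+1, val i \notin J.
  apply/existsP; rewrite -negb_forall; apply/negP => /forallP all.
  have /uniq_leq_size : {subset [seq val i | i <- ord_enum n.+1] <= J} by move=> _ /mapP[i _ ->].
  rewrite val_ord_enum iota_uniq size_iota => /(_ isT).
  by rewrite sJ sZ ltnn.
apply: (hx i); apply: cfam_root => // z /hJ[j jJ [jn hj]].
apply/croot_bigAnd; exists (Ordinal jn) => //.
by rewrite mem_enum !inE -val_eqE; apply: contraNneq iJ => /= <-.
Qed.

Lemma cluster_validates s : Sigma_equiv n s -> validates cluster_SLO s.
Proof.
case=> [->|[->|[->|->]]]; last exact: cluster_iota.
- by move=> v; apply/cleP; split.
- by move=> v; apply/cleP; split.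
- move=> v; apply/cleP; split=> //= Z; rewrite /cfam /= => -[h|h|[sZ h]].
  + exact: Or32.
  + exact: Or31.
  + by apply: Or32; apply: (@cfam_root (v 0)) => // z /h[].
Qed.

Lemma cvar_ok k : cluster_ok (eq^~ k, fun Z => size Z = n /\ forall z, z \in Z -> z = k).
Proof. by []. Qed.

Definition cvar k : cluster := exist _ _ (@cvar_ok k).

Lemma croot_eval f z : croot (@eval cluster_SLO cvar f) z <-> z \in root_vars f.
Proof.
elim: f => [k||f IHf g IHg|f _] //=.
- by rewrite inE; split=> [->|/eqP].
- rewrite mem_cat; split=> [[/IHf->|/IHg->]|/orP[/IHf|/IHg]]; rewrite ?orbT //; by [left|right].
Qed.

(** Under [cvar] the value of a formula records exactly what [label_crit] compares. The empty label
    of [Top] or of a diamond contributes nothing, since a tuple has n > 0 entries. *)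
Lemma cfam_eval f Z : cfam (@eval cluster_SLO cvar f) Z <->
  size Z = n /\ exists2 P, P \in labels f & {subset Z <= P}.
Proof.
have nilP : size Z = n -> ~ {subset Z <= [::]}.
  by case: Z n_gt0 => [|z Z] + sZ; rewrite -sZ // => _ /(_ z); rewrite inE eqxx => /(_ isT).
elim: f => [k||f IHf g IHg|f IHf].
- split=> [[sZ h]|[sZ [P]]].
    by split=> //; exists [:: k]; rewrite ?inE // => z /h->; rewrite inE.
  by rewrite inE => /eqP-> h; split=> // z /h; rewrite inE => /eqP.
- by split=> // -[sZ [P]]; rewrite inE => /eqP-> /nilP; apply.
- split=> [[/IHf[sZ [P Pf ZP]]|/IHg[sZ [P Pg ZP]]|[sZ h]]|].
  + by split=> //; exists P; rewrite // inE mem_cat Pf orbT.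
  + by split=> //; exists P; rewrite // inE mem_cat Pg !orbT.
  + split=> //; exists (root_vars f ++ root_vars g); first by rewrite inE eqxx.
    by move=> z /h[/croot_eval|/croot_eval]; rewrite mem_cat => ->; rewrite ?orbT.
  + case=> sZ [P]; rewrite [labels _]/= inE mem_cat => /or3P[/eqP->|Pf|Pg] ZP.
    * by apply: Or33; split=> // z /ZP; rewrite mem_cat => /orP[]/croot_eval; [left|right].
    * by apply: Or31; apply/IHf; split=> //; exists P.
    * by apply: Or32; apply/IHg; split=> //; exists P.
- split=> [/IHf[sZ [P Pf ZP]]|[sZ [P]]].
    by split=> //; exists P; rewrite // inE Pf orbT.
  rewrite [labels _]/= inE => /orP[/eqP->/(nilP sZ)//|Pf ZP].
  by apply/IHf; split=> //; exists P.
Qed.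

End Separation.

(** One algebra with one valuation refutes every implication that fails the criterion. *)
Lemma SPi_equivP n f g : 0 < n -> SPi_equiv n (f, g) <-> label_crit n f g.
Proof.
move=> n0; split=> [h|h A hA]; last exact: crit_sound hA _ _ h.
have /cleP[hR hC] := h _ (@cluster_validates n n0) (@cvar n).
split=> [z zg|Z P sZ Pg ZP]; first by apply/(croot_eval n0)/hR/croot_eval.
by have /hC/cfam_eval[] : cfam (@eval (cluster_SLO n0) (@cvar n) g) Z
  by apply/cfam_eval; split=> //; exists P.
Qed.

(** * First-order logic with a counting quantifier over words *)

Notation ord8 k := (@Ordinal 8 k isT).

(** The coding makes [sym] a finite type, as required for the tape alphabet and for conjunctions
    over all symbols. *)
Definition ord_of_sym (a : sym) : 'I_8 :=
  match a with
  | SVar => ord8 0 | S0 => ord8 1 | S1 => ord8 2 | SEnd => ord8 3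
  | STop => ord8 4 | SAnd => ord8 5 | SDia => ord8 6 | SImp => ord8 7
  end.

Definition sym_of_ord (i : 'I_8) : sym :=
  nth SVar [:: SVar; S0; S1; SEnd; STop; SAnd; SDia; SImp] i.

Lemma ord_of_symK : cancel ord_of_sym sym_of_ord.
Proof. by case. Qed.

HB.instance Definition _ := Finite.copy sym (can_type ord_of_symK).

Definition upd (e : nat -> nat) (x p : nat) : nat -> nat :=
  fun y => if y == x then p else e y.

Lemma upd_same e x p : upd e x p x = p.
Proof. by rewrite /upd eqxx. Qed.

Lemma upd_other e x p y : y < x -> upd e x p y = e y.
Proof. by rewrite /upd ltn_neqAle => /andP[/negPf->]. Qed.

(* [Resc x f g]: at most as many positions [x] satisfy [f] as satisfy [g]. *)
Inductive fo : Type :=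
  | Sy of nat & sym
  | Le of nat & nat
  | Not of fo
  | Conj of fo & fo
  | Resc of nat & fo & fo.

Fixpoint ev (w : seq sym) (e : nat -> nat) (f : fo) : bool :=
  match f with
  | Sy x a => onth w (e x) == Some a
  | Le x y => e x <= e y
  | Not f => ~~ ev w e f
  | Conj f g => ev w e f && ev w e g
  | Resc x f g => count (fun p => ev w (upd e x p) f) (iota 0 (size w)) <=
                  count (fun p => ev w (upd e x p) g) (iota 0 (size w))
  end.

(* Variables are de Bruijn levels: the binder at depth [d] is named [d]. *)
Fixpoint scoped (d : nat) (f : fo) : bool :=
  match f with
  | Sy x _ => x < d
  | Le x y => (x < d) && (y < d)
  | Not f => scoped d f
  | Conj f g => scoped d f && scoped d g
  | Resc x f g => [&& x == d, scoped d.+1 f & scoped d.+1 g]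
  end.

Lemma ev_ext w d f e e' : scoped d f -> (forall x, x < d -> e x = e' x) -> ev w e f = ev w e' f.
Proof.
elim: f d e e' => [x a|x y|f IHf|f IHf g IHg|x f IHf g IHg] d e e' /=.
- by move=> xd ->.
- by move=> /andP[xd yd] h; rewrite !h.
- by move=> sf h; rewrite (IHf d e e').
- by move=> /andP[sf sg] h; rewrite (IHf d e e') ?(IHg d e e').
- move=> /and3P[/eqP-> sf sg] h.
  have h' p x' : x' < d.+1 -> upd e d p x' = upd e' d p x'.
    by rewrite ltnS leq_eqVlt => /orP[/eqP->|?]; rewrite ?upd_same // !upd_other // h.
  rewrite (eq_count (a1 := fun p => ev w (upd e d p) f) (a2 := fun p => ev w (upd e' d p) f)).
    rewrite (eq_count (a1 := fun p => ev w (upd e d p) g) (a2 := fun p => ev w (upd e' d p) g)) //.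
    by move=> p; exact: IHg sg (h' p).
  by move=> p; exact: IHf sf (h' p).
Qed.

(** * Evaluation by a machine moving finitely many marks *)

(* A mark sits at a position [<= size w]; larger values mean that it is absent
   from the tape. *)
Inductive prim : Type :=
  | PSy of nat & option sym
  | PLe of nat & nat
  | PReset of nat
  | PInc of nat.

(** The answers are those that one pass from left to right can give, also for absent marks:
    [PLe x y] asks whether [x] is on the tape and not preceded by [y], and [PInc] reports whether
    its mark stood on the last cell. With [None], [PSy] recognises position [size w], one past the
    last letter. *)
Definition psem (w : seq sym) (p : prim) (e : nat -> nat) : bool * (nat -> nat) :=
  match p with
  | PSy x o => ((e x <= size w) && (onth w (e x) == o), e)
  | PLe x y => ((e x <= size w) && (e x <= e y), e)
  | PReset x => (true, upd e x 0)
  | PInc x => (e x == size w, upd e x (e x).+1)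
  end.

Section Flowchart.
Variables (Q : Type) (code : Q -> prim * (bool -> Q + bool)) (w : seq sym).

Definition fstep (c : (Q + bool) * (nat -> nat)) : (Q + bool) * (nat -> nat) :=
  match c.1 with
  | inl q => let: (r, e) := psem w (code q).1 c.2 in ((code q).2 r, e)
  | inr _ => c
  end.

Lemma iter_halted t b e : iter t fstep (inr b, e) = (inr b, e).
Proof. by elim: t => //= t ->. Qed.

End Flowchart.

Definition lift (Q Q' : Type) (h : Q -> Q') (ex : bool -> Q' + bool) (c : Q + bool) : Q' + bool :=
  match c with inl q => inl (h q) | inr b => ex b end.

(** The host program proceeds to [ex b] as soon as the subprogram answers, whereas [iter] keeps a
    halted run idle; hence the possibly smaller number of steps. *)
Lemma flow_embed (Q Q' : Type) (code : Q -> prim * (bool -> Q + bool))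
    (code' : Q' -> prim * (bool -> Q' + bool)) (h : Q -> Q') ex w :
  (forall q, code' (h q) = ((code q).1, fun r => lift h ex ((code q).2 r))) ->
  forall t q e b e', iter t (fstep code w) (inl q, e) = (inr b, e') ->
  exists2 t', t' <= t & iter t' (fstep code' w) (inl (h q), e) = (ex b, e').
Proof.
move=> hc; elim=> [//|t IH] q e b e'; rewrite iterSr /fstep /=.
case E: (psem _ _ _) => [r e1]; case E2: ((code q).2 r) => [q'|b'].
  move=> /IH[t' tt' ht']; exists t'.+1 => //; rewrite iterSr -ht'.
  by rewrite {1}/fstep /= hc /= E E2.
rewrite iter_halted => -[<- <-]; exists 1 => //.
by rewrite /= /fstep /= hc /= E E2.
Qed.

(** The eight control states of a counting loop are three resets, the end test, the increments of
    the two counters and of the variable, and the final comparison. *)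
Fixpoint st (f : fo) : finType :=
  match f with
  | Sy _ _ | Le _ _ => unit
  | Not f => st f
  | Conj f g => (st f + st g)%type
  | Resc _ f g => ('I_8 + (st f + st g))%type
  end.

Fixpoint start (f : fo) : st f :=
  match f return st f with
  | Sy _ _ | Le _ _ => tt
  | Not f => start f
  | Conj f g => inl (start f)
  | Resc _ f g => inl ord0
  end.

(* Mark [3 * x] is the variable [x]; marks [3 * x + 1] and [3 * x + 2] count the
   positions satisfying the two sides of [Resc x]. *)
Fixpoint code (f : fo) : st f -> prim * (bool -> st f + bool) :=
  match f return st f -> prim * (bool -> st f + bool) with
  | Sy x a => fun _ => (PSy (3 * x) (Some a), inr)
  | Le x y => fun _ => (PLe (3 * x) (3 * y), inr)
  | Not f => fun q => let c := @code f q in (c.1, fun r => lift id (fun b => inr (~~ b)) (c.2 r))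
  | Conj f g => fun q =>
      match q with
      | inl q => let c := @code f q in
          (c.1, fun r => lift inl (fun b => if b then inl (inr (start g)) else inr false) (c.2 r))
      | inr q => let c := @code g q in (c.1, fun r => lift inr (fun b => inr b) (c.2 r))
      end
  | Resc x f g => fun q =>
      match q with
      | inl k =>
          match nat_of_ord k with
          | 0 => (PReset (3 * x), fun _ => inl (inl (ord8 1)))
          | 1 => (PReset (3 * x + 1), fun _ => inl (inl (ord8 2)))
          | 2 => (PReset (3 * x + 2), fun _ => inl (inl (ord8 3)))
          | 3 => (PSy (3 * x) None,
                  fun r => inl (if r then inl (ord8 7) else inr (inl (start f))))
          | 4 => (PInc (3 * x + 1), fun _ => inl (inr (inr (start g))))
          | 5 => (PInc (3 * x + 2), fun _ => inl (inl (ord8 6)))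
          | 6 => (PInc (3 * x), fun _ => inl (inl (ord8 3)))
          | _ => (PLe (3 * x + 1) (3 * x + 2), inr)
          end
      | inr (inl q) => let c := @code f q in
          (c.1, fun r => lift (fun q => inr (inl q))
             (fun b => inl (if b then inl (ord8 4) else inr (inr (start g)))) (c.2 r))
      | inr (inr q) => let c := @code g q in
          (c.1, fun r => lift (fun q => inr (inr q))
             (fun b => inl (inl (if b then ord8 5 else ord8 6))) (c.2 r))
      end
  end.

(** The 5 pays for three resets, the last end test and the comparison; the 4 pays, in each round,
    for the end test and at most three increments. *)
Fixpoint cost (f : fo) (m : nat) : nat :=
  match f with
  | Sy _ _ | Le _ _ => 1
  | Not f => cost f m
  | Conj f g => cost f m + cost g m
  | Resc _ f g => 5 + m * (4 + cost f m + cost g m)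
  end.

Lemma onth_lt (T : Type) (s : seq T) i : i < size s -> exists a, onth s i = Some a.
Proof. by rewrite -onthTE; case: (onth s i) => // a _; exists a. Qed.

(** Marks from 3d on are scratch space for a subprogram at depth d and may end up anywhere; the
    smaller ones belong to the enclosing loops and must survive. *)
Lemma code_run f d w e : scoped d f -> (forall x, x < d -> e (3 * x) < size w) ->
  exists t e', [/\ t <= cost f (size w),
    iter t (fstep (@code f) w) (inl (start f), e) = (inr (ev w (fun x => e (3 * x)) f), e')
    & forall y, y < 3 * d -> e' y = e y].
Proof.
elim: f d e => [x a|x y|f IHf|f IHf g IHg|x f IHf g IHg] d e /=.
- move=> xd h; exists 1, e; split=> //.
  by rewrite /= /fstep /= leq_eqVlt h // orbT.
- move=> /andP[xd yd] h; exists 1, e; split=> //.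
  by rewrite /= /fstep /= (ltnW (h _ xd)).
- move=> sf h; have [t [e' [ct rt pe]]] := IHf d e sf h.
  have [//|t' tt' rt'] := @flow_embed _ _ _ (@code (Not f)) id (fun b => inr (~~ b)) _ _ _ _ _ _ _ rt.
  by exists t', e'; split=> //; exact: leq_trans ct.
- move=> /andP[sf sg] h; have [t [e1 [ct rt pe1]]] := IHf d e sf h.
  have [//|t1 tt1 rt1] := @flow_embed _ _ _ (@code (Conj f g)) inl
      (fun b => if b then inl (inr (start g)) else inr false) _ _ _ _ _ _ _ rt.
  case E: (ev w _ f) in rt1 *; last first.
    by exists t1, e1; split=> //; lia.
  have [|t2 [e2 [ct2 rt2 pe2]]] := IHg d e1 sg.
    by move=> x xd; rewrite pe1 ?h //; lia.
  have [//|t3 tt3 rt3] := @flow_embed _ _ _ (@code (Conj f g)) inr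
      (fun b => inr b) _ _ _ _ _ _ _ rt2.
  exists (t3 + t1), e2; split; first by lia.
    rewrite iterD rt1 rt3 (@ev_ext _ d g _ (fun x => e (3 * x))) // => x xd.
    by rewrite pe1 //; lia.
  by move=> y yd; rewrite pe2 // pe1.
- move=> /and3P[/eqP xd sf sg] h; subst x; set m := size w.
  set F := fstep (@code (Resc d f g)) w.
  pose cf j := count (fun p => ev w (upd (fun x => e (3 * x)) d p) f) (iota 0 j).
  pose cg j := count (fun p => ev w (upd (fun x => e (3 * x)) d p) g) (iota 0 j).
  have loop j : j <= m -> exists t e', [/\ t <= 3 + j * (4 + cost f m + cost g m),
      iter t F (inl (inl ord0), e) = (inl (inl (ord8 3)), e'),
      forall y, y < 3 * d -> e' y = e y &
      [/\ e' (3 * d) = j, e' (3 * d + 1) = cf j & e' (3 * d + 2) = cg j]].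
    elim: j => [_|j IH ltj].
      exists 3, (upd (upd (upd e (3 * d) 0) (3 * d + 1) 0) (3 * d + 2) 0); split=> //.
        by move=> y yd; rewrite !upd_other //; lia.
      by rewrite /upd; split; do !case: ifP => //; lia.
    have [|t [e0 [ct rt0 pe0 [e0x e0f e0g]]]] := IH; first exact: ltnW.
    have r1 : F (inl (inl (ord8 3)), e0) = (inl (inr (inl (start f))), e0).
      have [a wa] := onth_lt ltj.
      by rewrite /F /fstep /= e0x wa andbF.
    have h0 x : x < d.+1 -> e0 (3 * x) < size w.
      by rewrite ltnS leq_eqVlt => /orP[/eqP->|xd]; [rewrite e0x | rewrite pe0 ?h //; lia].
    (* Formulas read only marks whose index is a multiple of 3, so advancing the first counter does
       not affect them. *)
    have ext (k : fo) (e1 : nat -> nat) : scoped d.+1 k ->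
        (forall y, y < 3 * d.+1 -> y != 3 * d + 1 -> e1 y = e0 y) ->
        ev w (fun x => e1 (3 * x)) k = ev w (upd (fun x => e (3 * x)) d j) k.
      move=> sk he1; apply: (ev_ext w sk) => x; rewrite ltnS leq_eqVlt => /orP[/eqP->|xd].
        by rewrite upd_same he1 ?e0x //; lia.
      by rewrite upd_other // he1 ?pe0 //; lia.
    have [t1 [e1 [ct1 rt1 pe1]]] := IHf d.+1 e0 sf h0.
    rewrite (ext f e0) // in rt1.
    have [//|t1' tt1' {}rt1] := @flow_embed _ _ _ (@code (Resc d f g)) (fun q => inr (inl q))
      (fun b => inl (if b then inl (ord8 4) else inr (inr (start g)))) _ _ _ _ _ _ _ rt1.
    set bf := ev w _ f in rt1.
    have [t2 [e2 [ct2 rt2 pe2]]] : exists t2 e2, [/\ t2 <= 1,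
        iter t2 F (inl (if bf then inl (ord8 4) else inr (inr (start g))), e1) =
          (inl (inr (inr (start g))), e2) &
        forall y, y < 3 * d.+1 -> e2 y = if y == 3 * d + 1 then e0 y + bf else e0 y].
      case: (bf).
        exists 1, (upd e1 (3 * d + 1) (e1 (3 * d + 1)).+1); split=> // y yd.
        rewrite /upd pe1; last by lia.
        by case: eqP => [->|_]; [rewrite [RHS]addn1 | exact: pe1].
      by exists 0, e1; split=> // y yd; rewrite pe1 // addn0 if_same.
    have h2 x : x < d.+1 -> e2 (3 * x) < size w.
      by move=> xd; rewrite pe2; [case: ifP; [lia | move=> _; exact: h0] | lia].
    have [t3 [e3 [ct3 rt3 pe3]]] := IHg d.+1 e2 sg h2.
    rewrite (ext g e2) // in rt3; last by move=> y yd /negPf ny; rewrite pe2 // ny.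
    have [//|t3' tt3' {}rt3] := @flow_embed _ _ _ (@code (Resc d f g)) (fun q => inr (inr q))
      (fun b => inl (inl (if b then ord8 5 else ord8 6))) _ _ _ _ _ _ _ rt3.
    set bg := ev w _ g in rt3.
    have [t4 [e4 [ct4 rt4 pe4]]] : exists t4 e4, [/\ t4 <= 1,
        iter t4 F (inl (inl (if bg then ord8 5 else ord8 6)), e3) =
          (inl (inl (ord8 6)), e4) &
        forall y, y < 3 * d.+1 -> e4 y = if y == 3 * d + 2 then e2 y + bg else e2 y].
      case: (bg).
        exists 1, (upd e3 (3 * d + 2) (e3 (3 * d + 2)).+1); split=> // y yd.
        rewrite /upd pe3; last by lia.
        by case: eqP => [->|_]; [rewrite [RHS]addn1 | exact: pe3].
      by exists 0, e3; split=> // y yd; rewrite pe3 // addn0 if_same.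
    pose e5 := upd e4 (3 * d) (e4 (3 * d)).+1.
    have r5 : F (inl (inl (ord8 6)), e4) = (inl (inl (ord8 3)), e5) by [].
    exists (1 + (t4 + (t3' + (t2 + (t1' + (1 + t)))))), e5; split.
    + by move: ct tt1' ct1 ct2 tt3' ct3 ct4; rewrite mulSn -/m; lia.
    + by rewrite !iterD rt0 [iter 1 F _]/= r1 rt1 rt2 rt3 rt4.
    + move=> y yd; rewrite /e5 upd_other // pe4; last by lia.
      by rewrite ifF ?pe2 ?ifF ?pe0 //; lia.
    + rewrite /cf /cg -[j.+1]addn1 iotaD !count_cat /= -/(cf j) -/(cg j) !addn0 add0n -/bf -/bg.
      rewrite -e0f -e0g -e0x /e5 /upd.
      by split; (do ?[rewrite pe4; last by lia]); (do ?[rewrite pe2; last by lia]);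
        do !case: ifP; lia.
  have [t [e0 [ct rt0 pe0 [e0x e0f e0g]]]] := loop m (leqnn m).
  exists (1 + (1 + t)), e0; split=> //.
  rewrite !iterD rt0 /=.
  have -> : F (inl (inl (ord8 3)), e0) = (inl (inl (ord8 7)), e0).
    by rewrite /F /fstep /= e0x leqnn onth_default.
  rewrite /F /fstep /= e0f e0g.
  (* A counter never exceeds the length of the word, so its mark is on the tape and [PLe] compares
     correctly. *)
  have -> // : cf m <= size w by rewrite (leq_trans (count_size _ _)) ?size_iota.
Qed.

(** * Simulation by a sweeping Turing machine *)

Definition pmax (p : prim) : nat :=
  match p with
  | PSy x _ | PReset x | PInc x => x
  | PLe x y => maxn x y
  end.

Section Sweep.
Variables (K : nat) (w : seq sym).

Definition cell : finType := ({ffun 'I_K -> bool} * option sym)%type.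

Definition look (a : cell) (x : nat) : bool := oapp (fun v => a.1 v) false (insub x).

Definition put (a : cell) (x : nat) (b : bool) : cell :=
  ([ffun v => if val v == x then b else a.1 v], a.2).

(** For the tests, [None] means undecided so far. For [PReset] it identifies the first cell, the
    only one to receive the mark; for [PInc] the state remembers whether the previous cell carried
    the mark, which is thus shifted by one. *)
Definition sweep (p : prim) (s : option bool) (a : cell) : option bool * cell :=
  match p with
  | PSy x o => (if look a x then Some (a.2 == o) else s, a)
  | PLe x y => (if s is Some _ then s else
                if look a x then Some true else if look a y then Some false else None, a)
  | PReset x => (Some true, put a x (s == None))
  | PInc x => (Some (look a x), put a x (s == Some true))
  end.

Definition cell_at (e : nat -> nat) (i : nat) : cell :=
  ([ffun v : 'I_K => e v == i], onth w i).

Lemma look_cell e i x : x < K -> look (cell_at e i) x = (e x == i).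
Proof. by move=> xK; rewrite /look insubT /= ffunE. Qed.

Definition sweep_state (p : prim) (e : nat -> nat) (j : nat) : option bool :=
  match p with
  | PSy x o => if e x < j then Some (onth w (e x) == o) else None
  | PLe x y => if (e x < j) || (e y < j) then Some (e x <= e y) else None
  | PReset x => if j is 0 then None else Some true
  | PInc x => if j is j'.+1 then Some (e x == j') else None
  end.

Lemma sweep_cell p e j : pmax p < K ->
  sweep p (sweep_state p e j) (cell_at e j) =
  (sweep_state p e j.+1, cell_at (psem w p e).2 j).
Proof.
case: p => [x o|x y|x|x] /= hK.
- by rewrite look_cell // ltnS [e x <= j]leq_eqVlt /=; case: eqP => [->|].
- rewrite !look_cell; try by move: hK; rewrite gtn_max => /andP[].
  congr pair; rewrite !ltnS [e x <= j]leq_eqVlt [e y <= j]leq_eqVlt.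
  by case: (ltngtP (e x) j) => hx; case: (ltngtP (e y) j) => hy //=; congr Some; lia.
- congr pair; rewrite /put /cell_at /=; congr pair; apply/ffunP => v; rewrite !ffunE /upd.
  by case: eqP => // _; case: j.
- rewrite look_cell //; congr pair; rewrite /put /cell_at /=; congr pair.
  apply/ffunP => v; rewrite !ffunE /upd; case: eqP => // _.
  by case: j => //= j; rewrite eqSS; case: (e x == j).
Qed.

Lemma sweep_result p e : (sweep_state p e (size w).+1 == Some true) = (psem w p e).1.
Proof.
case: p => [x o|x y|x|x] //=; rewrite ?ltnS.
- by case: (e x <= size w) => //=; case: (onth w (e x) == o).
- case: (leqP (e x) (size w)) => hx /=; first by case: (e x <= e y).
  by case: (leqP (e y) (size w)) => hy //=; apply/eqP => -[]; lia.
- by case: (e x == size w).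
Qed.

End Sweep.

Section Machine.
Variables (Q : finType) (q0 : Q) (code : Q -> prim * (bool -> Q + bool)).

Definition marks : nat := (\max_(q : Q) pmax (code q).1).+1.

Lemma pmax_marks q : pmax (code q).1 < marks.
Proof. exact: leq_bigmax. Qed.

(* [inl (q, s)]: sweeping right for instruction [q]; [inr (inl q)]: returning
   to the left end, [q] next; [inr (inr b)]: halted with answer [b]. *)
Definition sweep_delta (c : (Q * option bool + (Q + bool))%type) (a : cell marks) :
    (Q * option bool + (Q + bool))%type * cell marks * dir :=
  match c with
  | inl (q, s) =>
      let: (s', a') := sweep (code q).1 s a in
      if a.2 is Some _ then (inl (q, s'), a', MoveR) else
      match (code q).2 (s' == Some true) with
      | inl q' => (inr (inl q'), a', MoveL)
      | inr b => (inr (inr b), a', Stay)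
      end
  | inr (inl q) => if a.2 is Some _ then (c, a, MoveL) else (inl (q, None), a, MoveR)
  | inr (inr _) => (c, a, Stay)
  end.

Definition blank_cell : cell marks := ([ffun=> false], None).

Definition sweep_TM : TM sym :=
  @Build_TM sym (Q * option bool + (Q + bool))%type (cell marks) blank_cell
    (fun a => ([ffun=> false], Some a)) (inl (q0, None)) (inr (inr true)) (inr (inr false))
    sweep_delta.

Variable w : seq sym.
Notation m := (size w).
Notation step := (@tm_step _ sweep_TM).
Notation cells e := (map (cell_at marks w e)).

Definition move_left (q : tm_state sweep_TM) (l r : seq (cell marks)) : config sweep_TM :=
  if l is x :: l' then (q, l', x :: r) else (q, [::], blank_cell :: r).

(** The blank cell to the left of the input stops the return. It is materialised by the first return
    and is present in [l] from then on. *)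
Lemma sweep_return q e j l r : j <= m -> l = [::] \/ l = [:: blank_cell] ->
  iter j.+1 step (move_left (inr (inl q)) (rev (cells e (iota 0 j)) ++ l) r) =
  (inl (q, None), [:: blank_cell], cells e (iota 0 j) ++ r).
Proof.
move=> + hl; elim: j r => [|j IH] r jm; first by case: hl => ->.
have [a wa] := onth_lt jm; set c := cell_at marks w e j.
have -> : move_left (inr (inl q)) (rev (cells e (iota 0 j.+1)) ++ l) r =
    (inr (inl q), rev (cells e (iota 0 j)) ++ l, c :: r).
  by rewrite -[j.+1]addn1 iotaD map_cat rev_cat.
have E : step (inr (inl q), rev (cells e (iota 0 j)) ++ l, c :: r) =
    move_left (inr (inl q)) (rev (cells e (iota 0 j)) ++ l) (c :: r).
  by rewrite /tm_step /= wa /move_left; case: (_ ++ l).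
by rewrite iterSr E IH ?(ltnW jm) // -[j.+1]addn1 iotaD map_cat -catA.
Qed.

Lemma sweep_scan q e l t j : j <= m ->
  iter j step (inl (q, None), l, cells e (iota 0 m) ++ t) =
  (inl (q, sweep_state w (code q).1 e j),
   rev (cells (psem w (code q).1 e).2 (iota 0 j)) ++ l, cells e (iota j (m - j)) ++ t).
Proof.
elim: j => [_|j IH jm].
  by rewrite subn0 /=; case: (code q).1.
rewrite iterS (IH (ltnW jm)) -(subnSK jm).
have -> e1 : rev (cells e1 (iota 0 j.+1)) = cell_at marks w e1 j :: rev (cells e1 (iota 0 j)).
  by rewrite -[j.+1]addn1 iotaD map_cat rev_cat.
have [a wa] := onth_lt jm.
by rewrite /= /tm_step /= sweep_cell ?pmax_marks //= wa.
Qed.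

(* [t] is the rightmost cell, which is still missing in the first sweep. *)
Lemma sweep_step q e l t : l = [::] \/ l = [:: blank_cell] ->
  head blank_cell t = cell_at marks w e m -> behead t = [::] ->
  match fstep code w (inl q, e) with
  | (inl q', e') => iter (2 * m.+1) step (inl (q, None), l, cells e (iota 0 m) ++ t) =
      (inl (q', None), [:: blank_cell], cells e' (iota 0 m) ++ [:: cell_at marks w e' m])
  | (inr b, _) => cstate (iter m.+1 step (inl (q, None), l, cells e (iota 0 m) ++ t)) =
      inr (inr b)
  end.
Proof.
move=> hl ht1 ht2; case E: (psem w (code q).1 e) => [r e'].
have -> : fstep code w (inl q, e) = ((code q).2 r, e') by rewrite /fstep /= E.
have scan : iter m.+1 step (inl (q, None), l, cells e (iota 0 m) ++ t) =
    match (code q).2 r with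
    | inl q' => move_left (inr (inl q')) (rev (cells e' (iota 0 m)) ++ l) [:: cell_at marks w e' m]
    | inr b => (inr (inr b), rev (cells e' (iota 0 m)) ++ l, [:: cell_at marks w e' m])
    end.
  rewrite iterS sweep_scan // subnn /= /tm_step /= ht1 sweep_cell ?pmax_marks //.
  rewrite [(cell_at marks w e m).2]onth_default // sweep_result E /= ht2.
  by case: ((code q).2 r).
case E2: ((code q).2 r) => [q'|b]; rewrite E2 in scan; last by rewrite scan.
(* The letters and the end cell take m+1 steps rightwards; the return, including the turn on the
   left blank, takes m+1 more. *)
by rewrite mul2n -addnn iterD scan sweep_return.
Qed.

Lemma sweep_run k q e l t b e' : l = [::] \/ l = [:: blank_cell] ->
  head blank_cell t = cell_at marks w e m -> behead t = [::] ->
  iter k (fstep code w) (inl q, e) = (inr b, e') ->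
  exists2 k', k' <= k * (2 * m.+1) &
    cstate (iter k' step (inl (q, None), l, cells e (iota 0 m) ++ t)) = inr (inr b).
Proof.
elim: k q e l t => [//|k IH] q e l t hl ht1 ht2; rewrite iterSr.
have := sweep_step q hl ht1 ht2; case: (fstep _ _ _) => [[q1|b1] e1].
  move=> E /(IH _ _ _ [:: cell_at marks w e1 m] (or_intror erefl) erefl erefl)[k' hk' Ek'].
  exists (k' + 2 * m.+1); first by rewrite mulSn addnC leq_add2l.
  by rewrite iterD E.
by move=> E; rewrite iter_halted => -[<- _]; exists m.+1; rewrite // mulSn; lia.
Qed.

(** The input tape carries no marks, which is the environment placing every mark at m+1, just beyond
    the end cell m. *)
Lemma sweep_init k b e' :
  iter k (fstep code w) (inl q0, fun=> m.+1) = (inr b, e') ->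
  exists2 k', k' <= k * (2 * m.+1) & cstate (tm_run sweep_TM k' w) = inr (inr b).
Proof.
have E : cells (fun=> m.+1) (iota 0 m) = map (tm_input sweep_TM) w.
  apply: (@eq_from_nth _ blank_cell) => [|i]; rewrite !size_map size_iota // => im.
  rewrite (nth_map 0) ?size_iota // (nth_map STop) // nth_iota // add0n.
  rewrite /cell_at /=; congr pair; first by apply/ffunP => v; rewrite !ffunE; lia.
  by have [a wa] := onth_lt im; rewrite wa (onth_nth _ _ _ _ wa).
move=> /(sweep_run (l := [::]) (t := [::]))[||//|k' hk' h]; first by left.
  by rewrite /cell_at onth_default //=; congr pair; apply/ffunP => v; rewrite !ffunE; lia.
by exists k' => //; rewrite /tm_run /tm_init /= -E; move: h; rewrite cats0.
Qed.

End Machine.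

(** * Polynomial bounds and the time needed to evaluate a formula *)

Definition poly_bounded (F : nat -> nat) : Prop := exists c d, forall m, F m <= c * m.+1 ^ d.

Lemma poly_boundedC c : poly_bounded (fun=> c).
Proof. by exists c, 0 => m; rewrite expn0 muln1. Qed.

Lemma poly_boundedS : poly_bounded succn.
Proof. by exists 1, 1 => m; rewrite expn1 mul1n. Qed.

Lemma poly_boundedD F G : poly_bounded F -> poly_bounded G -> poly_bounded (fun m => F m + G m).
Proof.
move=> [c [d hF]] [c' [d' hG]]; exists (c + c'), (d + d') => m.
rewrite mulnDl leq_add //.
  by apply: leq_trans (hF m) _; rewrite leq_mul2l leq_pexp2l ?leq_addr ?orbT.
by apply: leq_trans (hG m) _; rewrite leq_mul2l leq_pexp2l ?leq_addl ?orbT.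
Qed.

Lemma poly_boundedM F G : poly_bounded F -> poly_bounded G -> poly_bounded (fun m => F m * G m).
Proof.
move=> [c [d hF]] [c' [d' hG]]; exists (c * c'), (d + d') => m.
by rewrite expnD mulnACA leq_mul.
Qed.

Lemma poly_bounded_le F G : (forall m, F m <= G m) -> poly_bounded G -> poly_bounded F.
Proof. by move=> FG [c [d hG]]; exists c, d => m; exact: leq_trans (FG m) (hG m). Qed.

Lemma poly_bounded_cost f : poly_bounded (cost f).
Proof.
elim: f => [x a|x y|f IHf|f IHf g IHg|x f IHf g IHg] /=; try exact: poly_boundedC.
- exact: IHf.
- exact: poly_boundedD.
- apply: poly_boundedD (poly_boundedC 5) _.
  apply: (@poly_bounded_le _ (fun m => m.+1 * (4 + cost f m + cost g m))).
    by move=> m; rewrite leq_mul2r leqnSn orbT.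
  apply: poly_boundedM poly_boundedS _; apply: poly_boundedD IHg.
  exact: poly_boundedD (poly_boundedC 4) IHf.
Qed.

(** Each flowchart step is one sweep of at most 2(m+1) machine steps. A closed formula ignores its
    environment, so evaluation can start on the tape without marks. *)
Theorem fo_poly_time f (L : seq sym -> Prop) : scoped 0 f ->
  (forall w e, ev w e f <-> L w) -> poly_time_decidable L.
Proof.
move=> sf fL; pose M := sweep_TM (start f) (@code f).
have [c [d hcd]] : poly_bounded (fun m => cost f m * (2 * m.+1)).
  apply: poly_boundedM (poly_bounded_cost f) _.
  exact: poly_boundedM (poly_boundedC 2) poly_boundedS.
exists M, c, d => w.
have [//|k [e' [hk rk _]]] := @code_run f 0 w (fun=> (size w).+1) sf.
have [k' hk' E] := sweep_init rk.
exists k'; split.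
  by apply: leq_trans (hcd _); apply: leq_trans hk' _; rewrite leq_mul2r hk orbT.
rewrite E /halted -(fL w (fun=> (size w).+1)) /=.
by case: (ev w _ f); split=> //; split=> // -[].
Qed.

(** * Positions in encoded formulas *)

Notation enc := enc_form.

(** A variable is counted at its [SEnd] and not at its [SVar], so that a leaf counts only once its
    name has been read completely. *)
Definition leaf (a : sym) : bool := (a == SEnd) || (a == STop).
Definition isand (a : sym) : bool := a == SAnd.
Definition isbit (a : sym) : bool := (a == S0) || (a == S1).

Lemma pos_bits_bit p : all isbit (pos_bits p).
Proof. by elim: p => //= p IH; rewrite all_rcons IH. Qed.

Lemma nat_bits_bit k : all isbit (nat_bits k).
Proof. by rewrite /nat_bits; case: N.of_nat => // p; exact: pos_bits_bit. Qed.

Lemma pos_bits_inj : injective pos_bits.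
Proof.
have nz p : pos_bits p != [::] by case: p => //= p; rewrite -size_eq0 size_rcons.
elim=> [p IH|p IH|] [q|q|] //=.
- by move=> /rcons_inj[/IH->].
- by move=> /rcons_inj[].
- by case: (pos_bits p) (nz p) => [//|a [|b s]].
- by move=> /rcons_inj[].
- by move=> /rcons_inj[/IH->].
- by case: (pos_bits p) (nz p) => [//|a [|b s]].
- by case: (pos_bits q) (nz q) => [//|a [|b s]].
- by case: (pos_bits q) (nz q) => [//|a [|b s]].
Qed.

Lemma pos_bits_head p : head S0 (pos_bits p) = S1.
Proof. by elim: p => //= p; case: (pos_bits p). Qed.

Lemma nat_bits_inj : injective nat_bits.
Proof.
move=> k k'; rewrite /nat_bits => E; apply: Nnat.Nat2N.inj; move: E.
case: (N.of_nat k) => [|p]; case: (N.of_nat k') => [|q] //.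
- by move=> E; have := pos_bits_head q; rewrite -E.
- by move=> E; have := pos_bits_head p; rewrite E.
- by move=> /pos_bits_inj->.
Qed.

Lemma pos_bits_surj s : all isbit s -> exists p, pos_bits p = S1 :: s.
Proof.
elim/last_ind: s => [|s a IH]; first by exists xH.
rewrite all_rcons => /andP[/orP[]/eqP-> /IH[p Ep]].
  by exists (xO p); rewrite /= Ep.
by exists (xI p); rewrite /= Ep.
Qed.

Lemma count_bits (a : pred sym) s : ~~ a S0 -> ~~ a S1 -> all isbit s -> count a s = 0.
Proof.
move=> a0 a1 /allP h; apply/eqP; rewrite eqn0Ngt -has_count; apply/hasPn => x /h.
by case/orP => /eqP->.
Qed.

Lemma count_nat_bits (a : pred sym) k : ~~ a S0 -> ~~ a S1 -> count a (nat_bits k) = 0.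
Proof. by move=> a0 a1; apply: count_bits => //; exact: nat_bits_bit. Qed.

Lemma enc_leaves f : count leaf (enc f) = (count isand (enc f)).+1.
Proof.
elim: f => [k||f IHf g IHg|f IHf] //=.
- by rewrite !count_cat !count_nat_bits.
- by rewrite !count_cat IHf IHg; lia.
Qed.

(** The Lukasiewicz property: together with [enc_leaves], the end of a formula is the first place
    where leaves outnumber conjunctions. Diamonds, being unary, do not count. *)
Lemma enc_prefix f k : k < size (enc f) ->
  count leaf (take k (enc f)) <= count isand (take k (enc f)).
Proof.
elim: f k => [j||f IHf g IHg|f IHf] [|k] //=; rewrite ltnS.
- rewrite size_cat addn1 ltnS => kj; rewrite takel_cat //.
  rewrite (@count_bits leaf) //; apply/allP => a /mem_take.
  exact/allP/nat_bits_bit.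
- rewrite size_cat take_cat => h; case: ltnP => kf; first by rewrite (leq_trans (IHf _ kf)) // leq_addl.
  have := IHg (k - size (enc f)); rewrite !count_cat enc_leaves; lia.
- by move/IHf; lia.
Qed.

(** The terminator differs from every bit, so agreement up to and including the first [SEnd] also
    rules out that one name is a proper prefix of the other. *)
Lemma bits_agree s s' : all isbit s -> all isbit s' ->
  (forall t, t <= size s -> t <= size s' ->
     (forall t', t' < t -> onth (s ++ [:: SEnd]) t' <> Some SEnd) ->
     onth (s ++ [:: SEnd]) t = onth (s' ++ [:: SEnd]) t) -> s = s'.
Proof.
elim: s s' => [|a s IH] [|a' s'] //=.
- by move=> _ /andP[a'b _] h; have [Ea] : Some SEnd = Some a' by [exact: h 0 _ _ _]; move: a'b; rewrite -Ea.
- by move=> /andP[ab _] _ h; have [Ea] : Some a = Some SEnd by [exact: h 0 _ _ _]; move: ab; rewrite Ea.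
- move=> /andP[ab sb] /andP[_ s'b] h; have [->] : Some a = Some a' by [exact: h 0 _ _ _].
  congr cons.
  apply: IH => // t ts ts' ht; apply: (h t.+1) => // -[_ /= [Ea]|t' /ht //].
  by move: ab; rewrite Ea.
Qed.

Section Positions.
Variable w : seq sym.
Notation m := (size w).

Definition slice (b x : nat) : seq sym := take (x - b) (drop b w).

Definition bal (b x : nat) : Prop := count leaf (slice b x) <= count isand (slice b x).

(* For the start [b] of a subformula: [i] lies inside this subformula. *)
Definition anc (b i : nat) : Prop := b <= i /\ forall x, b <= x <= i -> bal b x.

(* [i] is an occurrence of a root variable of the subformula starting at [b]. *)
Definition lab (b i : nat) : Prop :=
  [/\ onth w i = Some SVar, anc b i &
      forall d, b <= d <= i -> onth w d = Some SDia -> ~ anc d i].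

Definition occ (o : nat) (f : spform) : Prop :=
  exists pre post, w = pre ++ enc f ++ post /\ size pre = o.

Lemma onth_size (i : nat) (a : sym) : onth w i = Some a -> i < m.
Proof. by move=> E; rewrite -onthTE E. Qed.

Lemma occ_size o f : occ o f -> o + size (enc f) <= m.
Proof. by case=> pre [post [-> <-]]; rewrite !size_cat; lia. Qed.

Lemma occ_onth o f i : occ o f -> i < size (enc f) -> onth w (o + i) = onth (enc f) i.
Proof.
case=> pre [post [-> <-]] lti; rewrite onth_cat ifF; last by lia.
by rewrite addKn onth_cat lti.
Qed.

Lemma occ_And o f g : occ o (And f g) ->
  [/\ onth w o = Some SAnd, occ o.+1 f & occ (o.+1 + size (enc f)) g].
Proof.
move=> h; split; first by rewrite -[o]addn0 (occ_onth h).
  case: h => pre [post [E <-]]; exists (rcons pre SAnd), (enc g ++ post).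
  by rewrite size_rcons cat_rcons E /= -catA.
case: h => pre [post [E <-]]; exists (rcons pre SAnd ++ enc f), post.
by rewrite size_cat size_rcons -!catA cat_rcons E /= -catA.
Qed.

Lemma occ_Dia o f : occ o (Dia f) -> onth w o = Some SDia /\ occ o.+1 f.
Proof.
move=> h; split; first by rewrite -[o]addn0 (occ_onth h).
case: h => pre [post [E <-]]; exists (rcons pre SDia), post.
by rewrite size_rcons cat_rcons E.
Qed.

Lemma occ_Var o k i : occ o (Var k) -> o < i < o + size (enc (Var k)) ->
  exists2 a, onth w i = Some a & isbit a || (a == SEnd).
Proof.
move=> h /andP[oi]; rewrite -ltn_subLR; last exact: ltnW.
move=> hi; have := occ_onth h hi; rewrite subnKC; last exact: ltnW.
move=> E; have [a wa] := onth_lt hi; exists a; first by rewrite E.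
move: wa; rewrite -(subnSK oi) /= => wa.
have : a \in nat_bits k ++ [:: SEnd] by apply/onthP; exists (i - o.+1).
rewrite mem_cat inE => /orP[h'|->]; last by rewrite orbT.
by rewrite (allP (nat_bits_bit k) _ h').
Qed.

Lemma occ_slice o f x : occ o f -> o <= x < o + size (enc f) ->
  slice o x = take (x - o) (enc f).
Proof.
case=> pre [post [E <-]] h; rewrite /slice E drop_size_cat // takel_cat //; lia.
Qed.

Lemma occ_slice_full o f : occ o f -> slice o (o + size (enc f)) = enc f.
Proof.
by case=> pre [post [E <-]]; rewrite /slice E addKn drop_size_cat // take_size_cat.
Qed.

Lemma anc_in o f i : occ o f -> o <= i < o + size (enc f) -> anc o i.
Proof.
move=> h hi; split; first by lia.
move=> x hx; rewrite /bal (occ_slice h); last by lia.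
by apply: enc_prefix; lia.
Qed.

Lemma anc_out o f i : occ o f -> o + size (enc f) <= i -> ~ anc o i.
Proof.
move=> h hi [_ /(_ (o + size (enc f)))]; rewrite /bal (occ_slice_full h) enc_leaves hi leq_addr.
by move=> /(_ isT); rewrite ltnn.
Qed.

(** The scope of a diamond ends within any formula containing it. Hence diamonds in a left conjunct
    do not hide root variables of the right one. *)
Lemma anc_dia_out o f d i : occ o f -> o <= d < o + size (enc f) ->
  onth w d = Some SDia -> o + size (enc f) <= i -> ~ anc d i.
Proof.
elim: f o => [k||f IHf g IHg|f IHf] o h hd wd hi.
- have [E|ne] := eqVneq d o; first by move: wd; rewrite E -[o]addn0 (occ_onth h).
  have [|a] := @occ_Var _ _ d h; first by lia.
  by rewrite wd => -[<-].
- have E : d = o by move: hd => /=; lia.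
  by move: wd; rewrite E -[o]addn0 (occ_onth h).
- have [wo hf hg] := occ_And h; move: hd hi; rewrite /= size_cat => hd hi.
  have [E|ne] := eqVneq d o; first by move: wd; rewrite E wo.
  have [df|df] := ltnP d (o.+1 + size (enc f)); first by apply: (IHf o.+1) => //; lia.
  by apply: (IHg (o.+1 + size (enc f))) => //; lia.
- have [wo hf] := occ_Dia h; move: (hd) (hi); rewrite /= => hd' hi'.
  have [->|ne] := eqVneq d o; first exact: anc_out h hi.
  by apply: (IHf o.+1) => //; lia.
Qed.

Lemma lab_rt o f i : occ o f -> lab o i ->
  o <= i < o + size (enc f) /\ exists2 k, k \in root_vars f & occ i (Var k).
Proof.
move=> h [wi hanc hdia].
have hi : o <= i < o + size (enc f).
  by case: (hanc) => -> _ /=; rewrite ltnNge; apply/negP => /(anc_out h).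
split=> //; move: hi hdia {hanc}.
elim: f o h => [k||f IHf g IHg|f IHf] o h hi hdia.
- have [E|ne] := eqVneq i o; first by exists k; rewrite ?inE // E.
  have [|a] := @occ_Var _ _ i h; first by lia.
  by rewrite wi => -[<-].
- have E : i = o by move: hi => /=; lia.
  by move: wi; rewrite E -[o]addn0 (occ_onth h).
- have [wo hf hg] := occ_And h; move: hi; rewrite /= size_cat => hi.
  have [E|ne] := eqVneq i o; first by move: wi; rewrite E wo.
  have [df|df] := ltnP i (o.+1 + size (enc f)).
    have [||k kf ok] := IHf o.+1 hf; first by lia.
      by move=> d hd; apply: hdia; lia.
    by exists k; rewrite // mem_cat kf.
  have [||k kf ok] := IHg (o.+1 + size (enc f)) hg; first by lia.
    by move=> d hd; apply: hdia; lia.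
  by exists k; rewrite // mem_cat kf orbT.
- have [wo hf] := occ_Dia h.
  case: (hdia o) => //; [by lia | exact: anc_in h hi].
Qed.

Lemma rt_lab o f k : occ o f -> k \in root_vars f -> exists2 i, lab o i & occ i (Var k).
Proof.
move=> h kf.
suff [i [hi hk hd]] : exists i, [/\ o <= i < o + size (enc f), occ i (Var k) &
    forall d, o <= d <= i -> onth w d = Some SDia -> ~ anc d i].
  exists i => //; split=> //; last exact: anc_in h hi.
  by rewrite -[i]addn0 (occ_onth hk).
elim: f o h kf => [j||f IHf g IHg|f IHf] o h //=.
- rewrite inE => /eqP E; exists o; split; rewrite ?E //; first by lia.
  move=> d hd; have -> : d = o by lia.
  by rewrite -[o in onth _ o]addn0 (occ_onth h).
- have [wo hf hg] := occ_And h; rewrite mem_cat size_cat => /orP[/(IHf _ hf)|/(IHg _ hg)].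
    move=> [i [hi hk hd]]; exists i; split=> //; first by lia.
    move=> d hd'; have [->|ne] := eqVneq d o; first by rewrite wo.
    by apply: hd; lia.
  move=> [i [hi hk hd]]; exists i; split=> //; first by lia.
  move=> d hd'; have [->|ne] := eqVneq d o; first by rewrite wo.
  have [df|df] := ltnP d (o.+1 + size (enc f)); last by apply: hd; lia.
  by move=> wd; apply: (anc_dia_out hf _ wd); lia.
Qed.

Lemma labs_occ o f P : occ o f -> P \in labels f ->
  exists b g, [/\ o <= b < o + size (enc f), occ b g & root_vars g = P].
Proof.
have ne g : 0 < size (enc g) by case: g => *; rewrite //= size_cat.
elim: f o => [j||f IHf g IHg|f IHf] o h.
- by rewrite inE => /eqP->; exists o, (Var j); split=> //=; lia.
- by rewrite inE => /eqP->; exists o, Top; split=> //=; lia.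
- rewrite [labels _]/= inE => /orP[/eqP->|].
    by exists o, (And f g); split=> //=; lia.
  have [wo hf hg] := occ_And h; rewrite mem_cat [enc (And _ _)]/= [size (_ :: _)]/= size_cat.
  move=> /orP[/(IHf _ hf)|/(IHg _ hg)] [b [h' [hb ob E]]]; exists b, h'; split=> //; lia.
- rewrite [labels _]/= inE => /orP[/eqP->|].
    by exists o, (Dia f); split=> //=; lia.
  have [wo hf] := occ_Dia h; move=> /(IHf _ hf) [b [h' [hb ob E]]].
  by exists b, h'; split=> //=; lia.
Qed.

(** This allows quantification over all positions [b]: one inside a variable name has no label,
    since the word from there to the end of the name has one leaf, [SEnd], and no conjunction. *)
Lemma lab_occ o f b i : occ o f -> o <= b < o + size (enc f) -> lab b i ->
  exists2 g, occ b g & root_vars g \in labels f.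
Proof.
move=> + + hl; elim: f o => [j||f IHf g IHg|f IHf] o h hb;
  (have [->|ne] := eqVneq b o; first by [exists (Var j); rewrite ?inE |
   exists Top; rewrite ?inE | exists (And f g); rewrite // inE eqxx |
   exists (Dia f); rewrite // inE eqxx]).
- case: hl => wi [bi hbal] _.
  have [iv|iv] := ltnP i (o + size (enc (Var j))).
    have [|a] := @occ_Var _ _ i h; first by lia.
    by rewrite wi => -[<-].
  have [c Ec] : exists c, b - o = c.+1 by exists (b - o).-1; lia.
  have cj : c <= size (nat_bits j) by move: hb; rewrite /= size_cat /=; lia.
  suff E : slice b (o + size (enc (Var j))) = drop c (nat_bits j) ++ [:: SEnd].
    have : bal b (o + size (enc (Var j))) by apply: hbal; lia.
    rewrite /bal E !count_cat (@count_bits isand) //; first by rewrite addn0 addn1.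
    by apply/allP => a /mem_drop; apply/allP/nat_bits_bit.
  case: h => pre [post [E so]]; rewrite /slice E (_ : b = c.+1 + o); last by lia.
  have Ed : drop c.+1 (enc (Var j)) = drop c (nat_bits j) ++ [:: SEnd].
    rewrite /= drop_cat; case: ltnP => // jc; have -> : c = size (nat_bits j) by lia.
    by rewrite subnn drop_size.
  rewrite -drop_drop -so drop_size_cat // drop_cat ifT; last by rewrite /= size_cat /=; lia.
  by rewrite Ed take_size_cat // -Ed size_drop; lia.
- by move: hb => /=; lia.
- have [wo hf hg] := occ_And h; move: hb; rewrite /= size_cat => hb.
  have [bf|bf] := ltnP b (o.+1 + size (enc f)).
    have [|g' og Pg] := IHf o.+1 hf; first by lia.
    by exists g'; rewrite // inE mem_cat Pg orbT.
  have [|g' og Pg] := IHg _ hg; first by lia.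
  by exists g'; rewrite // inE mem_cat Pg !orbT.
- have [wo hf] := occ_Dia h; have [|g' og Pg] := IHf o.+1 hf; first by move: hb => /=; lia.
  by exists g'; rewrite // inE Pg orbT.
Qed.

(* The words after [i] and [j] agree up to the first [SEnd]. *)
Definition same_var (i j : nat) : Prop :=
  forall x y, i <= x < m -> j <= y < m -> x - i = y - j ->
  (forall z, i <= z < x -> onth w z <> Some SEnd) -> onth w x = onth w y.

Lemma same_varP i j k k' : occ i (Var k) -> occ j (Var k') -> same_var i j <-> k = k'.
Proof.
move=> oi oj; split=> [h|E]; last first.
  rewrite -E in oj => x y hx hy Exy hz.
  have hxs : x - i < size (enc (Var k)).
    rewrite ltnNge; apply/negP => hs; apply: (hz (i + (size (nat_bits k)).+1)).
      by move: hs; rewrite /= size_cat /=; lia.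
    rewrite (occ_onth oi) /=; last by rewrite size_cat /=; lia.
    by rewrite onth_cat ltnn subnn.
  have := occ_onth oi hxs; have := occ_onth oj; rewrite Exy in hxs * => /(_ _ hxs).
  by rewrite -[in i + _]Exy !subnKC; [move=> -> -> | lia | lia].
apply/nat_bits_inj/bits_agree; try exact: nat_bits_bit.
move=> t tk tk' ht; have sk j' : size (enc (Var j')) = (size (nat_bits j')).+2.
  by rewrite /= size_cat addn1.
have := occ_size oi; have := occ_size oj => sj si.
have -> : onth (nat_bits k ++ [:: SEnd]) t = onth w (i + t.+1) by rewrite (occ_onth oi) // sk.
have -> : onth (nat_bits k' ++ [:: SEnd]) t = onth w (j + t.+1) by rewrite (occ_onth oj) // sk.
rewrite !sk in si sj; apply: h; [lia|lia|lia|] => z hz.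
have -> : z = i + (z - i) by lia.
rewrite (occ_onth oi); last by rewrite sk; lia.
by case E: (z - i) => [|t'] //=; apply: ht; lia.
Qed.

End Positions.

(** * Recognising encodings *)

Definition bitlike (a : sym) : bool := isbit a || (a == SEnd).

(** Counting leaves and conjunctions does not see how names are spelled; these conditions on
    neighbours confine bits and [SEnd] to names. *)
Definition okpair (a b : sym) : bool :=
  match a with
  | SVar => isbit b
  | S0 | S1 => bitlike b
  | _ => ~~ bitlike b
  end.

(* The middle conjunct excludes leading zeros. *)
Fixpoint lok (a : sym) (u : seq sym) : bool :=
  if u is b :: u' then
    [&& okpair a b, (a == SVar) && (b == S0) ==> (head SEnd u' == SEnd) & lok b u']
  else true.

Lemma lok_catl a u v : lok a (u ++ v) -> lok a u.
Proof.
elim: u a => //= b u IH a /and3P[-> h /IH->]; rewrite andbT /=.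
by case: u h {IH} => //=; rewrite eqxx implybT.
Qed.

Lemma lok_catr a u b v : lok a (u ++ b :: v) -> lok b v.
Proof. by elim: u a => /= [|c u IH] a /and3P[_ _] //; exact: IH. Qed.

(** The same continuations are admissible after all of these symbols, so [STop] can stand for the
    beginning of a word. *)
Definition boundary (a : sym) : bool := ~~ (isbit a || (a == SVar)).

Lemma lok_boundary a a' u : boundary a -> boundary a' -> lok a u = lok a' u.
Proof. by case: u => //= b u; case: a => //; case: a'. Qed.

Lemma lok_bits a s u : isbit a -> all isbit s -> lok STop u -> lok a (s ++ SEnd :: u).
Proof.
elim: s a => [|b s IH] a ab /= => [_ h|/andP[bb sb] h].
  by rewrite (lok_boundary _ (isT : boundary SEnd) (isT : boundary STop)) h; case: a ab.
by rewrite (IH b) //; case: a ab => //= _; rewrite /bitlike bb.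
Qed.

Lemma lok_enc a f u : boundary a -> lok STop u -> lok a (enc f ++ u).
Proof.
elim: f a u => [k||f IHf g IHg|f IHf] a u ba hu /=.
- rewrite -catA /=; have -> : okpair a SVar by case: a ba.
  have -> : (a == SVar) = false by case: a ba.
  rewrite /= /nat_bits; case: N.of_nat => [|p] /=.
    by rewrite (lok_boundary _ (isT : boundary SEnd) (isT : boundary STop)).
  have := pos_bits_bit p; have := pos_bits_head p; case: (pos_bits p) => //= b s -> sb.
  by rewrite lok_bits.
- by rewrite hu; case: a ba.
- rewrite -catA (IHf SAnd) ?IHg //; case: a ba => //.
- by rewrite (IHf SDia) //; case: a ba.
Qed.

Lemma lok_split_bits a u : isbit a -> lok a u ->
  all isbit u \/ exists s u', all isbit s /\ u = s ++ SEnd :: u'.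
Proof.
elim: u a => [|b u IH] a ab /=; first by left.
move=> /and3P[okb _ hu].
have [/eqP->|nb] := boolP (b == SEnd); first by right; exists [::], u.
have bb : isbit b by move: okb; case: a ab => //= _; rewrite /bitlike (negPf nb) orbF.
have [->|[s [u' [sb ->]]]] := IH b bb hu; first by left; rewrite bb.
by right; exists (b :: s), u'; rewrite /= bb sb.
Qed.

(** A later leaf forces the name to be terminated, because a word of bits contains none; without
    leading zeros the bits are the numeral of some number. *)
Lemma lok_split_var u : lok SVar u -> count leaf u > 0 ->
  exists k u', SVar :: u = enc (Var k) ++ u'.
Proof.
case: u => //= a u /and3P[ab hz hu] cu.
have [u0|[s [u' [sb E]]]] := lok_split_bits ab hu.
  by move: cu; rewrite count_bits //; case: a ab {hz hu}.
case: a ab hz hu cu => // _ /= hz hu cu.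
  case: s sb E => [_ E|b s /andP[bb _] E]; first by exists 0, u'; rewrite E.
  by move: hz bb; rewrite E /= => /eqP->.
have [p Ep] := pos_bits_surj sb; have [k Ek] : exists k, nat_bits k = S1 :: s.
  by exists (N.to_nat (Npos p)); rewrite /nat_bits N2Nat.id.
by exists k, u'; rewrite /= Ek E /= -catA.
Qed.

(* [k] is the number of formulas still expected. *)
Lemma parse_forest k u : lok STop u -> SImp \notin u ->
  (forall j, j < size u -> count leaf (take j u) < count isand (take j u) + k) ->
  count isand u + k <= count leaf u ->
  exists2 fs, size fs = k & u = flatten (map enc fs).
Proof.
have [N] := ubnP (size u); elim: N u k => // N IH [|a u] k.
  by move=> _ _ _ _ /=; rewrite add0n leqn0 => /eqP->; exists [::].
rewrite [size _]/= ltnS => su hl hi hp ht.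
have k0 : 0 < k by have := hp 0 isT; rewrite take0.
have hi' : SImp \notin u by move: hi; rewrite inE negb_or => /andP[].
have hp' j : j < size u -> leaf a + count leaf (take j u) < isand a + count isand (take j u) + k.
  by move=> ju; have := hp j.+1; rewrite /= ltnS => /(_ ju).
move: (hl); rewrite [lok _ _]/= => /andP[oka hl'].
case: k k0 hp hp' ht => // k _ hp hp' ht.
have stop : boundary STop by [].
case: a hl hl' hi hp hp' ht oka => // hl hl' hi hp hp' ht _.
- have [|j [u' E]] := lok_split_var hl'; first by move: ht => /=; lia.
  have ce (c : pred sym) : ~~ c S0 -> ~~ c S1 -> ~~ c SVar -> count c (enc (Var j)) = c SEnd.
    by move=> c0 c1 /negPf cv; rewrite /= cv count_cat count_nat_bits // /= addn0.
  have := congr1 size E; rewrite size_cat => sE.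
  have [|||||fs sf E'] := IH u' k.
  - by move: sE => /=; rewrite size_cat /=; lia.
  - move: hl; rewrite E [enc _]/= cat_cons -catA -cat_cons => /lok_catr.
    by rewrite (lok_boundary _ (isT : boundary SEnd) stop).
  - by move: hi; rewrite E mem_cat negb_or => /andP[].
  - move=> i iu; have := hp (size (enc (Var j)) + i).
    rewrite -[(size u).+1]/(size (SVar :: u)) sE ltn_add2l => /(_ iu).
    rewrite E take_cat ifF ?addKn; last by lia.
    by rewrite !count_cat !ce //=; lia.
  - by move: ht; rewrite E !count_cat !ce //=; lia.
  by exists (Var j :: fs); rewrite /= ?sf // E E'.
- have [|||||fs sf E'] := IH u k; rewrite //.
  - by move=> i iu; have := hp' i iu => /=; lia.
  - by move: ht => /=; lia.
  by exists (Top :: fs); rewrite /= ?sf // E'.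
(* A conjunction replaces one expected formula by two. *)
- have [|||||fs sf E'] := IH u k.+2; rewrite //.
  - by rewrite (lok_boundary _ stop (isT : boundary SAnd)).
  - by move=> i iu; have := hp' i iu => /=; lia.
  - by move: ht => /=; lia.
  case: fs sf E' => [|f [|g fs]] // [sf] E'.
  by exists (And f g :: fs); rewrite /= ?sf // E' /= !catA.
- have [|||||fs sf E'] := IH u k.+1; rewrite //.
  - by rewrite (lok_boundary _ stop (isT : boundary SDia)).
  case: fs sf E' => [|f fs] // [sf] E'.
  by exists (Dia f :: fs); rewrite /= ?sf // E'.
Qed.

Lemma parse_form u : lok STop u -> SImp \notin u ->
  (forall j, j < size u -> count leaf (take j u) <= count isand (take j u)) ->
  count isand u < count leaf u -> exists f, u = enc f.
Proof.
move=> hl hi hp ht; have [||[|f []] // _ E] := @parse_forest 1 u hl hi.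
- by move=> j ju; rewrite addn1 ltnS hp.
- by rewrite addn1.
- by exists f; rewrite E /= cats0.
Qed.

Lemma enc_SImp f : SImp \notin enc f.
Proof.
elim: f => [k||f IHf g IHg|f IHf] //=; rewrite inE /=.
- rewrite mem_cat negb_or andbT; apply/negP => h.
  by have := allP (nat_bits_bit k) _ h.
- by rewrite mem_cat negb_or IHf.
Qed.

(* [s] is the position of the implication sign. *)
Definition well_formed (w : seq sym) (s : nat) : Prop :=
  [/\ onth w s = Some SImp, forall x, onth w x = Some SImp -> x = s,
     (forall x, x < s -> bal w 0 x) /\ ~ bal w 0 s,
     (forall x, s < x < size w -> bal w s x) /\ ~ bal w s (size w) &
     lok STop w].

Lemma well_formedP w s :
  well_formed w s <-> exists f g, w = enc_imp (f, g) /\ s = size (enc f).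
Proof.
split=> [[ws us [p1 t1] [p2 t2] hl]|[f [g [Ew Es]]]].
  have sw := onth_size ws.
  have E : w = take s w ++ SImp :: drop s.+1 w.
    by rewrite -[LHS](cat_take_drop s) (drop_nth SImp) // (onth_nth _ _ _ _ ws).
  have sz : size (take s w) = s by rewrite size_take sw.
  have [||||f Ef] := @parse_form (take s w).
  - by move: hl; rewrite {1}E => /lok_catl.
  - apply/negP => /onthP[i wi]; have si := onth_size wi; rewrite sz in si.
    have : i = s by apply: us; rewrite E onth_cat sz si.
    by lia.
  - move=> j; rewrite sz => js; have := p1 j js; rewrite /bal /slice drop0 subn0 take_takel //.
    exact: ltnW.
  - by rewrite ltnNge; apply/negP => h; apply: t1; rewrite /bal /slice drop0 subn0.
  have dE : drop s w = SImp :: drop s.+1 w by rewrite (drop_nth SImp) // (onth_nth _ _ _ _ ws).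
  have [||||g Eg] := @parse_form (drop s.+1 w).
  - move: hl; rewrite {1}E => /lok_catr.
    by rewrite (lok_boundary _ (isT : boundary SImp) (isT : boundary STop)).
  - apply/negP => /onthP[i wi].
    have : s.+1 + i = s; last by lia.
    apply: us; rewrite E onth_cat sz ifF; last by lia.
    by rewrite addSnnS addKn.
  (* The slice starts at [SImp], which is neither a leaf nor a conjunction, so the counts are those
     of the part after it. *)
  - move=> j; rewrite size_drop => js; have := p2 (s + j.+1).
    by rewrite /bal /slice addKn dE /=; apply; lia.
  - rewrite ltnNge; apply/negP => h; apply: t2; rewrite /bal /slice dE.
    by rewrite take_oversize //= size_drop; lia.
  by exists f, g; rewrite -Ef sz /enc_imp /= -Ef -Eg.
have oE : w = enc f ++ SImp :: enc g by [].
have sw : size w = s + (size (enc g)).+1 by rewrite oE size_cat Es.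
have dE : drop s w = SImp :: enc g by rewrite oE Es drop_size_cat.
have tE x : x <= s -> slice w 0 x = take x (enc f).
  by move=> xs; rewrite /slice drop0 subn0 oE takel_cat // -Es.
split.
- by rewrite oE onth_cat Es ltnn subnn.
- move=> x; rewrite oE onth_cat -Es; case: ltnP => [xs wx|xs].
    by case/negP: (enc_SImp f); apply/onthP; exists x.
  case E: (x - s) => [|y] /=; first by lia.
  by move=> wx; case/negP: (enc_SImp g); apply/onthP; exists y.
- split=> [x xs|]; rewrite /bal tE //; [|exact: ltnW|].
    by apply: enc_prefix; rewrite -Es.
  by rewrite Es take_size enc_leaves ltnn.
- split=> [x /andP[sx xw]|]; rewrite /bal /slice dE.
    have [y Ey] : exists y, x - s = y.+1 by exists (x - s).-1; lia.
    by rewrite Ey /=; apply: enc_prefix; lia.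
  by rewrite take_oversize /= ?enc_leaves ?ltnn //; lia.
- rewrite oE lok_enc //= -[enc g]cats0 (lok_boundary _ (isT : boundary SImp) (isT : boundary STop)).
  exact: lok_enc.
Qed.

(** * The criterion in terms of positions *)

Definition pos_crit (n : nat) (w : seq sym) (s : nat) : Prop :=
  (forall i, lab w s.+1 i -> exists2 j, lab w 0 j & same_var w i j) /\
  (forall b t, s < b < size w -> size t = n -> (forall i, i \in t -> lab w b i) ->
     exists2 b', b' < s & forall i, i \in t -> exists2 j, lab w b' j & same_var w i j).

Lemma pos_critP n f g : 0 < n ->
  pos_crit n (enc_imp (f, g)) (size (enc f)) <-> label_crit n f g.
Proof.
move=> n0; set w := enc_imp _; set s := size (enc f).
have of_ : occ w 0 f by exists [::], (SImp :: enc g).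
have og : occ w s.+1 g.
  by exists (rcons (enc f) SImp), [::]; rewrite size_rcons cats0 cat_rcons.
have sw : size w = s.+1 + size (enc g) by rewrite /w size_cat /= addnS.
split=> [[h1 h2]|[h1 h2]]; split.
- move=> k kg; have [i li oi] := rt_lab og kg; have [j lj sij] := h1 i li.
  have [_ [k' k'f oj]] := lab_rt of_ lj.
  by have -> : k = k' by apply/(same_varP oi oj).
- move=> Z P sZ Pg ZP; have [b [g' [hb ob Eg]]] := labs_occ og Pg.
  have [t [st ht hZ]] : exists t, [/\ size t = n, forall i, i \in t -> lab w b i &
      forall z, z \in Z -> exists2 i, i \in t & occ w i (Var z)].
    rewrite -sZ; elim: Z {sZ} ZP => [|z Z IH] ZP; first by exists [::].
    have [|t [st ht hZ]] := IH; first by move=> y yZ; apply: ZP; rewrite inE yZ orbT.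
    have [|i li oi] := @rt_lab _ _ g' z ob; first by rewrite Eg ZP // inE eqxx.
    exists (i :: t); split; first by rewrite /= st.
      by move=> y; rewrite inE => /orP[/eqP->|/ht].
    move=> y; rewrite inE => /orP[/eqP->|/hZ[j jt oj]]; first by exists i; rewrite // inE eqxx.
    by exists j; rewrite // inE jt orbT.
  have [|b' b's hb'] := h2 b t _ st ht; first by rewrite sw; lia.
  (* As n > 0 the tuple is nonempty; the label that one of its entries yields at [b'] shows that a
     subformula starts there. *)
  have [i it] : exists i, i \in t.
    by case: t st {ht hZ hb'} n0 => [<-|i t _] //; exists i; rewrite inE eqxx.
  have [j lj _] := hb' i it.
  have [|f' of' Pf] := lab_occ of_ _ lj; first by rewrite add0n.
  exists (root_vars f') => // z /hZ[i' i't oi'].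
  have [j' lj' sij] := hb' i' i't; have [_ [k kf oj]] := lab_rt of' lj'.
  by have -> : z = k by apply/(same_varP oi' oj).
- move=> i li; have [_ [k kg oi]] := lab_rt og li.
  have [j lj oj] := rt_lab of_ (h1 _ kg).
  by exists j => //; apply/(same_varP oi oj).
- move=> b t hb st ht.
  have [i it] : exists i, i \in t.
    by case: t st {ht} n0 => [<-|i t _] //; exists i; rewrite inE eqxx.
  have [|g' og' Pg] := lab_occ og _ (ht i it); first by move: hb; rewrite sw.
  have [Z [sZ ZP hZ]] : exists Z, [/\ size Z = n, {subset Z <= root_vars g'} &
      forall i, i \in t -> exists2 z, z \in Z & occ w i (Var z)].
    rewrite -st; elim: t {st it} ht => [|j t IH] ht; first by exists [::].
    have [|Z [sZ ZP hZ]] := IH; first by move=> y yt; apply: ht; rewrite inE yt orbT.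
    have [|_ [k kg oj]] := lab_rt og' (ht j _); first by rewrite inE eqxx.
    exists (k :: Z); split; first by rewrite /= sZ.
      by move=> y; rewrite inE => /orP[/eqP->|/ZP].
    move=> y; rewrite inE => /orP[/eqP->|/hZ[z zZ oz]]; first by exists k; rewrite // inE eqxx.
    by exists z; rewrite // inE zZ orbT.
  have [P Pf ZP'] := h2 Z _ sZ Pg ZP.
  have [b' [f' [hb' ob' Ef]]] := labs_occ of_ Pf.
  exists b'; first by move: hb'; rewrite add0n.
  move=> j /hZ[z /ZP' zP oz]; rewrite -Ef in zP.
  have [j' lj' oj'] := rt_lab ob' zP.
  by exists j' => //; apply/(same_varP oz oj').
Qed.

(** * The defining formula *)

Definition fImp (f g : fo) : fo := Not (Conj f (Not g)).
Definition fOr (f g : fo) : fo := fImp (Not f) g.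
Definition fLt (x y : nat) : fo := Not (Le y x).
(** The universal quantifier is a comparison with an unsatisfiable formula: at most zero positions
    violate [f]. *)
Definition fAll (l : nat) (f : fo) : fo := Resc l (Not f) (Conj f (Not f)).
Definition fEx (l : nat) (f : fo) : fo := Not (fAll l (Not f)).
(** [Le x x] plays the role of truth, which is why some variable in scope is supplied. *)
Definition fBig (x : nat) (s : seq fo) : fo := foldr Conj (Le x x) s.

Definition fBal (l b x : nat) : fo :=
  Resc l (Conj (Conj (Le b l) (fLt l x)) (fOr (Sy l SEnd) (Sy l STop)))
         (Conj (Conj (Le b l) (fLt l x)) (Sy l SAnd)).

(** Quantified variables denote positions below [size w], so the right end of the word needs a
    formula of its own. *)
Definition fBalEnd (l b : nat) : fo :=
  Resc l (Conj (Le b l) (fOr (Sy l SEnd) (Sy l STop))) (Conj (Le b l) (Sy l SAnd)).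

Definition fAnc (l b i : nat) : fo :=
  Conj (Le b i) (fAll l (fImp (Conj (Le b l) (Le l i)) (fBal l.+1 b l))).

Definition fLab (l b i : nat) : fo :=
  Conj (Sy i SVar) (Conj (fAnc l b i)
    (fAll l (fImp (Conj (Le b l) (Le l i)) (fImp (Sy l SDia) (Not (fAnc l.+1 l i)))))).

Definition fDist (l i x j y : nat) : fo :=
  Resc l (Conj (Le i l) (fLt l x)) (Conj (Le j l) (fLt l y)).

Definition fSameSym (x y : nat) : fo :=
  fBig x [seq fImp (Sy x a) (Sy y a) | a <- enum {: sym}].

Definition fSameVar (l i j : nat) : fo :=
  fAll l (fImp (Le i l) (fAll l.+1 (fImp (Le j l.+1)
    (fImp (Conj (fDist l.+2 i l j l.+1) (fDist l.+2 j l.+1 i l))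
      (fImp (fAll l.+2 (fImp (Conj (Le i l.+2) (fLt l.+2 l)) (Not (Sy l.+2 SEnd))))
        (fSameSym l l.+1)))))).

Definition fSucc (l x y : nat) : fo :=
  Conj (fLt x y) (fAll l (fImp (fLt x l) (Le y l))).

Definition fOkpair (x y : nat) : fo :=
  fBig x [seq fImp (Sy x ab.1) (Not (Sy y ab.2)) |
           ab <- enum {: sym * sym} & ~~ okpair ab.1 ab.2].

Definition fLok (l o : nat) : fo :=
  Conj (fBig o [seq Not (Sy o a) | a <- enum {: sym} & bitlike a])
    (fAll l (fAll l.+1 (fImp (fSucc l.+2 l l.+1)
       (Conj (fOkpair l l.+1)
         (fImp (Conj (Sy l SVar) (Sy l.+1 S0))
           (fAll l.+2 (fImp (fSucc l.+3 l.+1 l.+2) (Sy l.+2 SEnd)))))))).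

(* Variables 0 and 1 are the first position and the implication sign. *)
Definition fWell : fo :=
  fBig 0 [:: Sy 1 SImp;
    fAll 2 (fImp (Sy 2 SImp) (Conj (Le 1 2) (Le 2 1)));
    fAll 2 (fImp (fLt 2 1) (fBal 3 0 2)); Not (fBal 2 0 1);
    fAll 2 (fImp (fLt 1 2) (fBal 3 1 2)); Not (fBalEnd 2 1);
    fLok 2 0].

Definition fRoot : fo :=
  fAll 2 (fImp (fSucc 3 1 2) (fAll 3 (fImp (fLab 4 2 3)
    (fEx 4 (Conj (fLab 5 0 4) (fSameVar 5 3 4)))))).

(** Variable 2 is the position [b] in the conclusion; the tuple occupies variables 3 to n+2, one
    quantifier per entry. *)
Fixpoint fTuple (l k : nat) (f : fo) : fo :=
  if k is k'.+1 then fAll l (fImp (fLab l.+1 2 l) (fTuple l.+1 k' f)) else f.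

Definition fCover (n : nat) : fo :=
  fEx (3 + n) (Conj (fLt (3 + n) 1)
    (fBig 1 [seq fEx (4 + n) (Conj (fLab (5 + n) (3 + n) (4 + n)) (fSameVar (5 + n) i (4 + n)))
            | i <- iota 3 n])).

Definition fCrit (n : nat) : fo := fAll 2 (fImp (fLt 1 2) (fTuple 3 n (fCover n))).

Definition fLogic (n : nat) : fo :=
  fEx 0 (Conj (fAll 1 (Le 0 1)) (fEx 1 (Conj fWell (Conj fRoot (fCrit n))))).

(** * The defining formula is closed *)

Lemma scoped_all l f : scoped l.+1 f -> scoped l (fAll l f).
Proof. by rewrite /= eqxx => ->. Qed.

Lemma scoped_ex l f : scoped l.+1 f -> scoped l (fEx l f).
Proof. by rewrite /= eqxx => ->. Qed.

Lemma scoped_imp l f g : scoped l f -> scoped l g -> scoped l (fImp f g).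
Proof. by rewrite /= => -> ->. Qed.

Lemma scoped_conj l f g : scoped l f -> scoped l g -> scoped l (Conj f g).
Proof. by rewrite /= => -> ->. Qed.

Lemma scoped_big l x s : x < l -> all (scoped l) s -> scoped l (fBig x s).
Proof. by move=> xl; elim: s => [|f s IH] /=; rewrite ?xl // => /andP[-> /IH]. Qed.

Lemma scoped_lab l b i : b < l -> i < l -> scoped l (fLab l b i).
Proof. by move=> bl il /=; lia. Qed.

Lemma scoped_samevar l i j : i < l -> j < l -> scoped l (fSameVar l i j).
Proof.
move=> il jl; have h : scoped l.+2 (fSameSym l l.+1).
  by apply: scoped_big; [lia | rewrite all_map; apply/allP => a _ /=; lia].
by rewrite /= h; lia.
Qed.

Lemma scoped_lok l o : o < l -> scoped l (fLok l o).
Proof.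
move=> ol; have h : scoped l.+2 (fOkpair l l.+1).
  by apply: scoped_big; [lia | rewrite all_map; apply/allP => a _ /=; lia].
have h' : scoped l (fBig o [seq Not (Sy o a) | a <- enum {: sym} & bitlike a]).
  by apply: scoped_big; [lia | rewrite all_map; apply/allP => a _ /=; lia].
by rewrite [scoped _ _]/= h'; rewrite /= h; lia.
Qed.

Lemma scoped_tuple l k f : 2 < l -> scoped (l + k) f -> scoped l (fTuple l k f).
Proof.
elim: k l => [|k IH] l l2 sf; first by rewrite addn0 in sf.
apply/scoped_all/scoped_imp; first by apply: scoped_lab; lia.
by apply: IH; [lia | rewrite addSnnS].
Qed.

Lemma scoped_logic n : scoped 0 (fLogic n).
Proof.
apply/scoped_ex/scoped_conj => //; apply/scoped_ex/scoped_conj; last apply: scoped_conj.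
- have : scoped 2 (fLok 2 0) by exact: scoped_lok.
  by move=> h; apply: scoped_big => //; move: h => /= ->.
- apply/scoped_all/scoped_imp => //; apply/scoped_all/scoped_imp; first exact: scoped_lab.
  by apply/scoped_ex/scoped_conj; [exact: scoped_lab | exact: scoped_samevar].
- apply/scoped_all/scoped_imp => //; apply: scoped_tuple => //.
  apply/scoped_ex/scoped_conj; first by rewrite /=; lia.
  apply: scoped_big => //; rewrite all_map; apply/allP => i; rewrite mem_iota => hi.
  by apply/scoped_ex/scoped_conj; [apply: scoped_lab | apply: scoped_samevar]; lia.
Qed.

(** * Correctness of the defining formula *)

Section Semantics.
Variable w : seq sym.
Notation m := (size w).

Lemma ev_imp e f g : ev w e (fImp f g) <-> (ev w e f -> ev w e g).
Proof. by rewrite /=; case: (ev w e f); case: (ev w e g); split=> // /(_ isT). Qed.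

Lemma ev_conj e f g : ev w e (Conj f g) <-> ev w e f /\ ev w e g.
Proof. by split=> [/andP|/andP]. Qed.

Lemma ev_conjE e f g : ev w e (Conj f g) = ev w e f && ev w e g.
Proof. by []. Qed.

Lemma ev_le e x y : ev w e (Le x y) = (e x <= e y).
Proof. by []. Qed.

Lemma ev_not e f : ev w e (Not f) <-> ~ ev w e f.
Proof. by split=> [/negP|/negP]. Qed.

Lemma ev_or e f g : ev w e (fOr f g) = ev w e f || ev w e g.
Proof. by rewrite /= -negb_or negbK. Qed.

Lemma ev_lt e x y : ev w e (fLt x y) = (e x < e y).
Proof. by rewrite /= ltnNge. Qed.

Lemma ev_sy e x a : ev w e (Sy x a) <-> onth w (e x) = Some a.
Proof. by split=> /eqP. Qed.

Lemma ev_all e l f : ev w e (fAll l f) <-> forall p, p < m -> ev w (upd e l p) f.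
Proof.
rewrite /= [X in _ <= X](eq_count (a2 := pred0)); last by move=> p /=; rewrite andbN.
rewrite count_pred0 leqn0 -[_ == 0]negbK -lt0n -has_count.
split=> [/hasPn h p pm|h].
  by have := h p; rewrite negbK; apply; rewrite mem_iota.
by apply/hasPn => p; rewrite mem_iota negbK => /h.
Qed.

Lemma ev_ex e l f : ev w e (fEx l f) <-> exists2 p, p < m & ev w (upd e l p) f.
Proof.
split=> [|[p pm h]]; last by apply/ev_not => /ev_all/(_ p pm)/negP.
move=> /ev_not h; have [/hasP[p]|/hasPn hn] := boolP (has (fun p => ev w (upd e l p) f) (iota 0 m)).
  by rewrite mem_iota => pm fp; exists p.
by case: h; apply/ev_all => p pm; apply: (hn p); rewrite mem_iota.
Qed.

Lemma ev_big e x s : ev w e (fBig x s) = all (ev w e) s.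
Proof. by elim: s => [|f s IH] /=; rewrite ?leqnn // IH. Qed.

Lemma count_slice (a : pred sym) b x : b <= x <= m ->
  count (fun p => (b <= p) && (p < x) && oapp a false (onth w p)) (iota 0 m) =
  count a (slice w b x).
Proof.
move=> /andP[bx xm].
have -> : iota 0 m = iota 0 b ++ (iota b (x - b) ++ iota x (m - x)).
  by rewrite -[X in iota X (m - x)](subnKC bx) -!iotaD; congr iota; lia.
have z (r : seq nat) : (forall p, p \in r -> ~~ ((b <= p) && (p < x))) ->
    count (fun p => (b <= p) && (p < x) && oapp a false (onth w p)) r = 0.
  move=> h; apply/eqP; rewrite eqn0Ngt -has_count; apply/hasPn => p /h.
  by move=> /negPf->.
rewrite !count_cat z ?[X in _ + (_ + X)]z; first last.
- by move=> p; rewrite mem_iota; lia.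
- by move=> p; rewrite mem_iota; lia.
rewrite addn0 add0n; have -> : slice w b x = [seq nth SVar w p | p <- iota b (x - b)].
  rewrite /slice map_nth_iota // ; lia.
rewrite count_map; apply: eq_in_count => p; rewrite mem_iota => hp /=.
have [|c wc] := @onth_lt _ w p; first by lia.
by rewrite wc (onth_nth _ _ _ _ wc) /= (_ : (b <= p) && (p < x)) //; lia.
Qed.

Ltac updsimp := do ?[rewrite upd_same | rewrite upd_other; [|lia]].

Lemma ev_leaf e x : ev w e (fOr (Sy x SEnd) (Sy x STop)) = oapp leaf false (onth w (e x)).
Proof. by rewrite ev_or /=; case: (onth w (e x)) => // -[]. Qed.

Lemma ev_and e x : ev w e (Sy x SAnd) = oapp isand false (onth w (e x)).
Proof. by rewrite /=; case: (onth w (e x)) => // -[]. Qed.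

Lemma ev_bal e l b x : b < l -> x < l -> e b <= e x <= m ->
  ev w e (fBal l b x) <-> bal w (e b) (e x).
Proof.
move=> bl xl h; rewrite /bal -!count_slice //.
rewrite -(eq_count (a1 := fun p => ev w (upd e l p) (Conj (Conj (Le b l) (fLt l x))
  (fOr (Sy l SEnd) (Sy l STop))))) => [|p]; last first.
  by rewrite !ev_conjE ev_leaf ev_lt ev_le; updsimp.
rewrite -[X in _ <= X](eq_count (a1 := fun p => ev w (upd e l p)
  (Conj (Conj (Le b l) (fLt l x)) (Sy l SAnd)))) // => p.
by rewrite !ev_conjE ev_and ev_lt ev_le; updsimp.
Qed.

Lemma ev_balend e l b : b < l -> e b <= m ->
  ev w e (fBalEnd l b) <-> bal w (e b) m.
Proof.
move=> bl h; rewrite /bal -!count_slice ?h ?leqnn //.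
rewrite -(eq_in_count (a1 := fun p => ev w (upd e l p) (Conj (Le b l)
  (fOr (Sy l SEnd) (Sy l STop))))) => [|p]; last first.
  by rewrite mem_iota add0n => /andP[_ pm]; rewrite !ev_conjE ev_leaf ev_le pm andbT; updsimp.
rewrite -[X in _ <= X](eq_in_count (a1 := fun p => ev w (upd e l p)
  (Conj (Le b l) (Sy l SAnd)))) // => p.
by rewrite mem_iota add0n => /andP[_ pm]; rewrite !ev_conjE ev_and ev_le pm andbT; updsimp.
Qed.

Lemma ev_anc e l b i : b < l -> i < l -> e i < m ->
  ev w e (fAnc l b i) <-> anc w (e b) (e i).
Proof.
move=> bl il im; split=> [/ev_conj[bi /ev_all h]|[bi h]].
  split=> // x hx; have /ev_imp := h x (leq_ltn_trans (proj2 (andP hx)) im).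
  rewrite /= -/(fBal l.+1 b l); updsimp => /(_ hx)/ev_bal; updsimp; apply; lia.
apply/ev_conj; split=> //; apply/ev_all => p pm; apply/ev_imp; rewrite /=; updsimp => hp.
apply/ev_bal; updsimp; try lia; exact: h.
Qed.

Lemma ev_lab e l b i : b < l -> i < l ->
  ev w e (fLab l b i) <-> lab w (e b) (e i).
Proof.
move=> bl il; split.
  move=> /ev_conj[/ev_sy wi /ev_conj[ha /ev_all hd]]; have im := onth_size wi.
  split=> //; first exact/(ev_anc bl il im).
  move=> d hd' wd hanc; have /ev_imp := hd d (leq_ltn_trans (proj2 (andP hd')) im).
  rewrite [ev _ _ (Conj _ _)]/=; updsimp => /(_ hd')/ev_imp.
  rewrite [ev _ _ (Sy _ _)]/=; updsimp; rewrite wd eqxx => /(_ isT)/ev_not; apply.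
  by apply/ev_anc; updsimp => //; lia.
move=> [wi hanc hd]; have im := onth_size wi.
apply/ev_conj; split; first exact/ev_sy.
apply/ev_conj; split; first exact/ev_anc.
apply/ev_all => p pm; apply/ev_imp; rewrite [ev _ _ (Conj _ _)]/=; updsimp => hp.
apply/ev_imp => /ev_sy; updsimp => wp; apply/ev_not => /ev_anc; updsimp => h.
by apply: (hd p hp wp); apply: h; lia.
Qed.

(** Truncated subtraction agrees with counting: an interval whose end precedes its start is
    empty. *)
Lemma ev_dist e l i x j y : i < l -> x < l -> j < l -> y < l -> e x <= m -> e y <= m ->
  ev w e (fDist l i x j y) = (e x - e i <= e y - e j).
Proof.
have c a b : b <= m -> count (fun p => (a <= p) && (p < b)) (iota 0 m) = b - a.
  move=> bm; have [ab|ba] := leqP a b; last first.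
    rewrite (eq_count (a2 := pred0)) ?count_pred0; first by lia.
    by move=> p /=; lia.
  rewrite (eq_in_count (a2 := fun p => (a <= p) && (p < b) && oapp predT false (onth w p))).
    rewrite count_slice ?ab // count_predT /slice size_takel // size_drop; lia.
  move=> p; rewrite mem_iota => pm; have [|q ->] := @onth_lt _ w p; first by lia.
  by rewrite /= andbT.
move=> il xl jl yl xm ym; rewrite -!c //.
by congr (_ <= _); apply: eq_count => p; rewrite /= -ltnNge; updsimp.
Qed.

Lemma ev_samesym e x y : e x < m -> ev w e (fSameSym x y) <-> onth w (e x) = onth w (e y).
Proof.
move=> xm; rewrite /fSameSym ev_big all_map; split=> [/allP h|E].
  have [a wa] := onth_lt xm.
  have /ev_imp : ev w e (fImp (Sy x a) (Sy y a)) by apply: h; rewrite mem_enum.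
  by move=> h'; rewrite wa; apply/esym/ev_sy/h'/ev_sy.
by apply/allP => a _; apply/ev_imp => /ev_sy Ea; apply/ev_sy; rewrite -E.
Qed.

Lemma ev_samevar e l i j : i < l -> j < l -> ev w e (fSameVar l i j) <-> same_var w (e i) (e j).
Proof.
move=> il jl; split.
  move=> /ev_all h x y /andP[ix xm] /andP[jy ym] Exy hz.
  have /ev_imp := h x xm; rewrite [ev _ _ (Le _ _)]/=; updsimp => /(_ ix)/ev_all/(_ y ym)/ev_imp.
  rewrite [ev _ _ (Le _ _)]/=; updsimp => /(_ jy)/ev_imp h1.
  have /ev_imp h2 : ev w (upd (upd e l x) l.+1 y)
      (fImp (fAll l.+2 (fImp (Conj (Le i l.+2) (fLt l.+2 l)) (Not (Sy l.+2 SEnd)))) (fSameSym l l.+1)).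
    by apply: h1; apply/ev_conj; rewrite !ev_dist; updsimp; lia.
  have : ev w (upd (upd e l x) l.+1 y) (fSameSym l l.+1).
    apply: h2; apply/ev_all => z zm; apply/ev_imp; rewrite /= -ltnNge; updsimp => hz'.
    by apply/eqP; exact: hz.
  by move/ev_samesym; updsimp; apply.
move=> h; apply/ev_all => x xm; apply/ev_imp; rewrite [ev _ _ (Le _ _)]/=; updsimp => ix.
apply/ev_all => y ym; apply/ev_imp; rewrite [ev _ _ (Le _ _)]/=; updsimp => jy.
apply/ev_imp => /ev_conj; rewrite !ev_dist; updsimp; try lia; move=> hxy.
apply/ev_imp => /ev_all hz; apply/ev_samesym; updsimp => //.
apply: h; rewrite ?ix ?jy //; first by lia.
move=> z /[dup] hz' /andP[_ zx]; have /ev_imp := hz z (ltn_trans zx xm).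
rewrite [ev _ _ (Conj _ _)]/= -ltnNge; updsimp => /(_ hz')/ev_not h'.
by move=> wz; apply: h'; apply/ev_sy; updsimp.
Qed.

Lemma ev_succ e l x y : x < l -> y < l -> e y < m -> ev w e (fSucc l x y) <-> e y = (e x).+1.
Proof.
move=> xl yl ym; split=> [/ev_conj[]|E].
  rewrite ev_lt => xy /ev_all h; apply/eqP; rewrite eqn_leq xy andbT.
  have [|xm] := ltnP (e x).+1 m; last by lia.
  by move=> /h/ev_imp; rewrite ev_lt /=; updsimp; apply.
apply/ev_conj; split; first by rewrite ev_lt E.
by apply/ev_all => p pm; apply/ev_imp; rewrite ev_lt /=; updsimp; rewrite E.
Qed.

Lemma ev_okpair e x y a b : onth w (e x) = Some a -> onth w (e y) = Some b ->
  ev w e (fOkpair x y) <-> okpair a b.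
Proof.
move=> wx wy; rewrite /fOkpair ev_big all_map; split=> [/allP h|ok].
  apply/negPn/negP => nok.
  have /ev_imp : ev w e (fImp (Sy x a) (Not (Sy y b))).
    by apply: (h (a, b)); rewrite mem_filter mem_enum nok.
  by move=> h'; have /ev_not := h' (proj2 (ev_sy e x a) wx); apply; apply/ev_sy.
apply/allP => -[a' b']; rewrite mem_filter => /andP[nok _].
apply/ev_imp => /ev_sy; rewrite wx => -[Ea]; apply/ev_not => /ev_sy; rewrite wy => -[Eb].
by move: nok; rewrite /= -Ea -Eb ok.
Qed.

(** The recursive check becomes a condition on at most three consecutive positions, which
    quantifiers over positions can express. *)
Lemma lok_onth a u : lok a u <->
  (forall b, onth u 0 = Some b -> okpair a b /\
     (a = SVar -> b = S0 -> forall c, onth u 1 = Some c -> c = SEnd)) /\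
  (forall i b c, onth u i = Some b -> onth u i.+1 = Some c -> okpair b c /\
     (b = SVar -> c = S0 -> forall d, onth u i.+2 = Some d -> d = SEnd)).
Proof.
elim: u a => [|b u IH] a; first by split=> // _; split=> [b|i b c]; rewrite onth0n.
split=> [/= /and3P[oab hz /IH[h1 h2]]|[h1 h2]].
  split=> [b' [<-]|[|i] b' c'] /=.
  - split=> // Ea Eb; move: hz; rewrite Ea Eb eqxx /=.
    by case: u {IH h1 h2} => //= c u /eqP-> c' [].
  - by move=> [<-] /h1.
  - exact: h2.
have [oab hz] := h1 b erefl; rewrite /= oab /=; apply/andP; split.
  apply/implyP => /andP[/eqP Ea /eqP Eb]; apply/eqP.
  by case: u hz {IH h1 h2} => //= c u /(_ Ea Eb c erefl).
apply/IH; split=> [c|i c d] h; first exact: (h2 0).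
exact: (h2 i.+1).
Qed.

Lemma ev_lok e l o : o < l -> e o = 0 -> 0 < m -> ev w e (fLok l o) <-> lok STop w.
Proof.
move=> ol eo m0; have [a0 wa0] := onth_lt m0.
have first : ev w e (fBig o [seq Not (Sy o a) | a <- enum {: sym} & bitlike a]) <-> okpair STop a0.
  rewrite ev_big all_map; split=> [/allP h|ok].
    apply/negP => ba; have /ev_not : ev w e (Not (Sy o a0)).
      by apply: h; rewrite mem_filter ba mem_enum.
    by apply; apply/ev_sy; rewrite eo.
  apply/allP => a; rewrite mem_filter => /andP[ba _].
  apply/ev_not => /ev_sy; rewrite eo wa0 => -[Ea].
  by move/negP: ok; apply; rewrite Ea.
rewrite lok_onth; split=> [/ev_conj[/first ok0 /ev_all h]|[h1 h2]].
  split=> [b|i b c wb wc]; first by rewrite wa0 => -[<-].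
  have := h i (onth_size wb); move=> /ev_all/(_ _ (onth_size wc))/ev_imp.
  set e1 := upd _ _ _ => h1.
  have /h1 /ev_conj[/(@ev_okpair _ _ _ b c) h2 /ev_imp h3] : ev w e1 (fSucc l.+2 l l.+1).
    by apply/ev_succ; rewrite /e1; updsimp; rewrite ?(onth_size wc) //.
  split; first by apply: h2; rewrite /e1; updsimp.
  move=> Eb Ec d wd; have : ev w e1 (fAll l.+2 (fImp (fSucc l.+3 l.+1 l.+2) (Sy l.+2 SEnd))).
    by apply: h3; apply/ev_conj; split; apply/ev_sy; rewrite /e1; updsimp; rewrite -?Eb -?Ec.
  move=> /ev_all/(_ _ (onth_size wd))/ev_imp h4.
  have /ev_sy : ev w (upd e1 l.+2 i.+2) (Sy l.+2 SEnd).
    by apply/h4/ev_succ; rewrite /e1; updsimp; rewrite ?(onth_size wd).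
  by updsimp; rewrite wd => -[].
apply/ev_conj; split; first by apply/first; have [] := h1 _ wa0.
apply/ev_all => x xm; apply/ev_all => y ym; set e1 := upd _ _ _.
apply/ev_imp => /ev_succ; rewrite /e1; updsimp; rewrite -/e1 => h.
have Ey : y = x.+1 by apply: h.
have [a wa] := onth_lt xm; have [b wb] := onth_lt ym; rewrite Ey in wb.
have [ok hz] := h2 x a b wa wb.
apply/ev_conj; split.
  by apply/(@ev_okpair _ _ _ a b); rewrite /e1; updsimp; rewrite ?Ey.
apply/ev_imp => /ev_conj[/ev_sy ex /ev_sy ey]; apply/ev_all => z zm; apply/ev_imp => /ev_succ.
move: ex ey; rewrite /e1; updsimp; rewrite Ey wa wb => -[Ea] [Eb] h'.
have Ez : z = x.+2 by apply: h'.
have [d wd] := onth_lt zm; apply/ev_sy; updsimp; rewrite wd; congr Some.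
by apply: hz => //; rewrite -Ez.
Qed.

Lemma ev_well e : e 0 = 0 -> e 1 < m -> ev w e fWell <-> well_formed w (e 1).
Proof.
move=> e0 sm; rewrite /fWell ev_big.
have -> : all (ev w e) [:: Sy 1 SImp;
    fAll 2 (fImp (Sy 2 SImp) (Conj (Le 1 2) (Le 2 1)));
    fAll 2 (fImp (fLt 2 1) (fBal 3 0 2)); Not (fBal 2 0 1);
    fAll 2 (fImp (fLt 1 2) (fBal 3 1 2)); Not (fBalEnd 2 1); fLok 2 0] =
  [&& ev w e (Sy 1 SImp),
    ev w e (fAll 2 (fImp (Sy 2 SImp) (Conj (Le 1 2) (Le 2 1)))),
    ev w e (fAll 2 (fImp (fLt 2 1) (fBal 3 0 2))), ev w e (Not (fBal 2 0 1)),
    ev w e (fAll 2 (fImp (fLt 1 2) (fBal 3 1 2))), ev w e (Not (fBalEnd 2 1)) &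
    ev w e (fLok 2 0)] by rewrite -[all _ _]/[&& _, _, _, _, _, _, _ & true] andbT.
split.
  move=> /and5P[/ev_sy ws /ev_all us /ev_all p1 /ev_not t1 /and3P[/ev_all p2 /ev_not t2 hl]].
  split=> //.
  - move=> x wx; have /ev_imp := us x (onth_size wx).
    move=> /(_ (proj2 (ev_sy _ _ _) _))/ev_conj; rewrite !ev_le; updsimp => -[] //; lia.
  - split=> [x xs|h].
      have /ev_imp := p1 x (ltn_trans xs sm); rewrite ev_lt; updsimp => /(_ xs)/ev_bal.
      by updsimp; rewrite e0; apply; lia.
    by apply: t1; apply/ev_bal => //; rewrite e0 //; lia.
  - split=> [x /andP[xs xm]|h].
      have /ev_imp := p2 x xm; rewrite ev_lt; updsimp => /(_ xs)/ev_bal.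
      by updsimp; apply; lia.
    by apply: t2; apply/ev_balend => //; lia.
  - by apply/(ev_lok (l := 2) (o := 0) (e := e)) => //; lia.
move=> [ws us [p1 t1] [p2 t2] hl].
apply/and5P; split; last (apply/and3P; split).
- exact/ev_sy.
- apply/ev_all => x xm; apply/ev_imp => /ev_sy; updsimp => /us E.
  by apply/ev_conj; rewrite !ev_le; updsimp; rewrite E.
- apply/ev_all => x xm; apply/ev_imp; rewrite ev_lt; updsimp => xs.
  by apply/ev_bal; updsimp; rewrite ?e0 //; [lia | exact: p1].
- by apply/ev_not => /ev_bal; rewrite e0 => h; apply: t1; apply: h => //; lia.
- apply/ev_all => x xm; apply/ev_imp; rewrite ev_lt; updsimp => xs.
  by apply/ev_bal; updsimp => //; [lia | apply: p2; rewrite xs].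
- by apply/ev_not => /ev_balend h; apply: t2; apply: h => //; lia.
- by apply/ev_lok => //; lia.
Qed.

Lemma ev_root e : e 0 = 0 -> (e 1).+1 < m ->
  ev w e fRoot <-> forall i, lab w (e 1).+1 i -> exists2 j, lab w 0 j & same_var w i j.
Proof.
move=> e0 sm; split.
  move=> /ev_all/(_ _ sm)/ev_imp h i li; have [wi _ _] := li; have im := onth_size wi.
  have /ev_all/(_ i im)/ev_imp h1 : ev w (upd e 2 (e 1).+1) (fAll 3 (fImp (fLab 4 2 3)
    (fEx 4 (Conj (fLab 5 0 4) (fSameVar 5 3 4))))) by apply: h; apply/ev_succ; updsimp.
  have /ev_ex[j jm /ev_conj[/ev_lab h2 /ev_samevar h3]] : ev w (upd (upd e 2 (e 1).+1) 3 i)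
    (fEx 4 (Conj (fLab 5 0 4) (fSameVar 5 3 4))) by apply: h1; apply/ev_lab; updsimp.
  by exists j; [move: h2 | move: h3]; updsimp; rewrite ?e0; apply.
move=> h; apply/ev_all => b bm; apply/ev_imp => /ev_succ; updsimp => h'.
have Eb : b = (e 1).+1 by apply: h'.
apply/ev_all => i im; apply/ev_imp => /ev_lab; updsimp; rewrite Eb => h1.
have [|j lj sij] := h i; first exact: h1.
have [wj _ _] := lj; apply/ev_ex; exists j; first exact: onth_size wj.
by apply/ev_conj; split; [apply/ev_lab | apply/ev_samevar]; updsimp; rewrite ?e0.
Qed.

Fixpoint upds (e : nat -> nat) (l : nat) (t : seq nat) : nat -> nat :=
  if t is p :: t' then upds (upd e l p) l.+1 t' else e.

Lemma upds_lt e l t x : x < l -> upds e l t x = e x.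
Proof. by elim: t e l => //= p t IH e l xl; rewrite IH ?upd_other // ltnW. Qed.

Lemma upds_ge e l t i : i < size t -> upds e l t (l + i) = nth 0 t i.
Proof.
elim: t e l i => //= p t IH e l [|i] it; first by rewrite addn0 upds_lt ?upd_same.
by rewrite -addSnnS IH.
Qed.

Lemma ev_tuple e l k f : 2 < l -> ev w e (fTuple l k f) <->
  forall t, size t = k -> (forall i, i \in t -> lab w (e 2) i) -> ev w (upds e l t) f.
Proof.
elim: k e l => [|k IH] e l l2.
  by split=> [h [] //|h]; apply: (h [::]).
split.
  move=> /ev_all h [//|p t] [st] ht; have lp : lab w (e 2) p by apply: ht; rewrite inE eqxx.
  have [wp _ _] := lp; have /ev_imp h1 := h p (onth_size wp).
  have /IH : ev w (upd e l p) (fTuple l.+1 k f) by apply: h1; apply/ev_lab; updsimp => //; lia.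
  by apply=> //; [lia | move=> i it; updsimp; apply: ht; rewrite inE it orbT].
move=> h; apply/ev_all => p pm; apply/ev_imp => /ev_lab; updsimp => h1.
have lp : lab w (e 2) p by apply: h1; lia.
apply/IH; first by lia.
move=> t st ht; apply: (h (p :: t)); first by rewrite /= st.
by move=> i; rewrite inE => /orP[/eqP-> //|/ht]; updsimp.
Qed.

Lemma ev_cover e n : e 1 < m ->
  ev w e (fCover n) <->
  exists2 b, b < e 1 & forall i, i < n -> exists2 j, lab w b j & same_var w (e (3 + i)) j.
Proof.
move=> sm; split.
  move=> /ev_ex[b bm /ev_conj[]]; rewrite ev_lt; updsimp => bs.
  rewrite ev_big all_map => /allP h; exists b => // i ni.
  have hi : 3 + i \in iota 3 n by rewrite mem_iota; lia.
  have /ev_ex[j jm /ev_conj[/ev_lab h1 /ev_samevar h2]] : ev w (upd e (3 + n) b)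
    (fEx (4 + n) (Conj (fLab (5 + n) (3 + n) (4 + n)) (fSameVar (5 + n) (3 + i) (4 + n)))).
    exact: h hi.
  exists j; [move: h1 | move: h2]; updsimp; apply; lia.
move=> [b bs h]; apply/ev_ex; exists b; first exact: ltn_trans sm.
apply/ev_conj; split; first by rewrite ev_lt; updsimp.
rewrite ev_big all_map; apply/allP => i; rewrite mem_iota => ni.
have [|j lj sij] := h (i - 3); first by lia.
have [wj _ _] := lj; apply/ev_ex; exists j; first exact: onth_size wj.
rewrite (_ : 3 + (i - 3) = i) in sij; last by lia.
by apply/ev_conj; split; [apply/ev_lab | apply/ev_samevar]; updsimp => //; lia.
Qed.

Lemma ev_crit e n : e 1 < m ->
  ev w e (fCrit n) <->
  forall b t, e 1 < b < m -> size t = n -> (forall i, i \in t -> lab w b i) ->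
    exists2 b', b' < e 1 & forall i, i \in t -> exists2 j, lab w b' j & same_var w i j.
Proof.
move=> sm; split.
  move=> /ev_all h b t /andP[sb bm] st ht; have /ev_imp := h b bm; rewrite ev_lt; updsimp.
  move=> /(_ sb)/ev_tuple => /(_ isT t st); updsimp => /(_ ht)/ev_cover.
  rewrite upds_lt //; updsimp => /(_ sm)[b' b's h']; exists b' => // i it.
  have ni : index i t < n by rewrite -st index_mem.
  by have := h' _ ni; rewrite upds_ge ?st // nth_index.
move=> h; apply/ev_all => b bm; apply/ev_imp; rewrite ev_lt; updsimp => sb.
apply/ev_tuple => // t st; updsimp => ht; apply/ev_cover; rewrite upds_lt //; updsimp => //.
have [|b' b's h'] := h b t _ st ht; first by rewrite sb.
exists b' => // i ni; rewrite upds_ge ?st //; apply: h'; apply: mem_nth; by rewrite st.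
Qed.

Lemma ev_logic e n :
  ev w e (fLogic n) <-> exists s, well_formed w s /\ pos_crit n w s.
Proof.
(* The conclusion has a nonempty encoding, so the position after [SImp] exists; otherwise [fRoot]
   would hold vacuously. *)
have after s : well_formed w s -> s.+1 < m.
  move=> /well_formedP[f [g [-> ->]]]; rewrite size_cat /= -addn1 ltn_add2l.
  by case: g.
split.
  move=> /ev_ex[o om /ev_conj[/ev_all h0 /ev_ex[s sm /ev_conj[hw /ev_conj[hr hc]]]]].
  have eo : o = 0.
    have := h0 0 (leq_ltn_trans (leq0n o) om); rewrite ev_le; updsimp.
    by rewrite leqn0 => /eqP.
  exists s; have {}hw : well_formed w s by move/ev_well: hw; updsimp; apply.
  split=> //; split.
    by move/ev_root: hr; updsimp; apply => //; exact: after.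
  by move/ev_crit: hc; updsimp; apply.
move=> [s [hw [hr hc]]]; have sm := after _ hw.
apply/ev_ex; exists 0; first exact: leq_ltn_trans sm.
apply/ev_conj; split; first by apply/ev_all => p pm; rewrite ev_le; updsimp.
apply/ev_ex; exists s; first exact: ltnW.
apply/ev_conj; split; first by apply/ev_well; updsimp => //; exact: ltnW.
apply/ev_conj; split; first by apply/ev_root; updsimp.
by apply/ev_crit; updsimp => //; exact: ltnW.
Qed.

End Semantics.

Theorem theorem7p5 (n : nat) : 2 <= n ->
  poly_time_decidable (logic_language (SPi_equiv n)).
Proof.
move=> n2; apply: (fo_poly_time (scoped_logic n)) => w e.
have n0 : 0 < n by exact: ltnW.
split=> [/ev_logic[s [/well_formedP[f [g [-> ->]]] /(pos_critP _ _ n0) h]]|[[f g] [-> h]]].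
  by exists (f, g); split=> //; apply/SPi_equivP.
apply/ev_logic; exists (size (enc f)); split; first by apply/well_formedP; exists f, g.
by apply/(pos_critP _ _ n0)/SPi_equivP.
Qed.
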